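(* Let $\mathfrak{A}$ be a residually finite-dimensional $\mathrm{C}^*$-algebra and let $\pi$ be an irreducible $*$-representation of $\mathfrak{A}$. Assume that there is $n\in \mathbb{N}$ and $T\in \mathbb{M}_n(\mathfrak{A})$ with the property that \[ \|\pi^{(n)}(T)\|>\sup_{[\sigma]\in \mathcal{W}_\pi} \|\sigma^{(n)}(T)\| \] where $\mathcal{W}_\pi=\{[\sigma]\in \widehat{\mathfrak{A}}:\sigma\not\sim\pi\}$. Then, $\pi$ is finite-dimensional.
   Context: A $\mathrm{C}^*$-algebra is residually finite-dimensional if it admits a separating set of finite-dimensional $*$-representations. $\widehat{\mathfrak{A}}$ is the set of unitary equivalence classes $[\sigma]$ of irreducible $*$-representations $\sigma$ of $\mathfrak{A}$. Two irreducible $*$-representations are weakly equivalent, written $\sigma\sim\pi$, if $\ker\sigma=\ker\pi$. $\sigma^{(n)}$ is the entrywise ampliation of $\sigma$ to $\mathbb{M}_n(\mathfrak{A})$. A $*$-representation is finite-dimensional if it acts on a finite-dimensional Hilbert space. *)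

(* Defs.v *)
From HB Require Import structures.
From mathcomp Require Import all_boot all_order all_algebra.
From mathcomp Require Import complex.
From mathcomp Require Import all_classical all_reals all_analysis.

Set Implicit Arguments.
Unset Strict Implicit.
Unset Printing Implicit Defensive.

Import Order.TTheory GRing.Theory Num.Theory.
Import numFieldNormedType.Exports.

Local Open Scope classical_set_scope.
Local Open Scope complex_scope.
Local Open Scope ring_scope.

(* The norm of a normed module over R[i] takes values in R[i]; [rnorm x] is the
   same number seen in R. *)
Definition rnorm (R : realType) (V : normedModType R[i]) (x : V) : R :=
  complex.Re `|x|.

(* Not assumed to have a unit, so not based on the library's algebra
   structures. *)
HB.mixin Record CompleteNormedModule_isCStarAlgebra (R : realType) A
    of CompleteNormedModule R[i] A := {
  cmul : {bilinear A -> A -> A};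
  cmulA : forall a b c : A, cmul a (cmul b c) = cmul (cmul a b) c;
  cnormM : forall a b : A, `|cmul a b| <= `|a| * `|b|;
  cstar : A -> A;
  cstarD : forall a b : A, cstar (a + b) = cstar a + cstar b;
  cstarZ : forall (z : R[i]) (a : A), cstar (z *: a) = z^* *: cstar a;
  cstarM : forall a b : A, cstar (cmul a b) = cmul (cstar b) (cstar a);
  cstarK : involutive cstar;
  cnorm_star : forall a : A, `|cmul (cstar a) a| = `|a| ^+ 2
}.

#[short(type="cstarAlgType")]
HB.structure Definition CStarAlgebra (R : realType) :=
  {A of CompleteNormedModule R[i] A &
        CompleteNormedModule_isCStarAlgebra R A}.

(* [inner x y] is linear in x and conjugate-linear in y. *)
HB.mixin Record CompleteNormedModule_isHilbert (R : realType) H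
    of CompleteNormedModule R[i] H := {
  inner : {dot H for Num.conj};
  inner_norm : forall x : H, inner x x = `|x| ^+ 2
}.

#[short(type="hilbertType")]
HB.structure Definition Hilbert (R : realType) :=
  {H of CompleteNormedModule R[i] H & CompleteNormedModule_isHilbert R H}.

Record boundedOp (R : realType) (H : hilbertType R) := BoundedOp {
  op_fun :> {linear H -> H};
  op_continuous : continuous op_fun
}.

Section Operators.
Variables (R : realType) (H : hilbertType R) (n : nat).

Definition hsum_norm (x : 'I_n -> H) : R :=
  Num.sqrt (\sum_(i < n) rnorm (x i) ^+ 2).

Definition mxop_apply (S : 'M[boundedOp H]_n) (x : 'I_n -> H) : 'I_n -> H :=
  fun i => \sum_(j < n) S i j (x j).

(* Norm of M_n(B(H)) = B(H^n), where H^n is the Hilbert direct sum. *)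
Definition mxop_norm (S : 'M[boundedOp H]_n) : \bar R :=
  ereal_sup [set (hsum_norm (mxop_apply S x))%:E
            | x in [set x : 'I_n -> H | hsum_norm x <= 1]].

End Operators.

Record starRep (R : realType) (A : cstarAlgType R) := StarRep {
  rep_space : hilbertType R;
  rep_fun :> A -> boundedOp rep_space;
  rep_linear : forall (z : R[i]) (a b : A) (x : rep_space),
    rep_fun (z *: a + b) x = z *: rep_fun a x + rep_fun b x;
  rep_mul : forall (a b : A) (x : rep_space),
    rep_fun (cmul a b) x = rep_fun a (rep_fun b x);
  rep_star : forall (a : A) (x y : rep_space),
    inner (rep_fun a x) y = inner x (rep_fun (cstar a) y)
}.

Definition finite_dim (K : fieldType) (V : lmodType K) : Prop :=
  exists (d : nat) (v : 'I_d -> V),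
    forall x : V, exists c : 'I_d -> K, x = \sum_(i < d) c i *: v i.

Definition closed_subspace (R : realType) (H : hilbertType R) (M : set H) :
    Prop :=
  [/\ M 0, (forall (z : R[i]) (x y : H), M x -> M y -> M (z *: x + y))
    & closed M].

Section Representations.
Variables (R : realType) (A : cstarAlgType R).
Implicit Types (s t p : starRep A).

(* [set (starRep A)] is ruled out by universe constraints of the library, hence
   the explicit predicates. *)
Definition rep_set := starRep A -> Prop.

Definition finite_dim_rep s : Prop := finite_dim (rep_space s).

Definition residually_finite_dim : Prop :=
  exists F : rep_set,
    (forall s, F s -> finite_dim_rep s) /\
    (forall a b : A, (forall s, F s -> forall x, s a x = s b x) -> a = b).

(* The nonvanishing clause excludes the zero representation on the zero space
   and on a one-dimensional space. *)
Definition irreducible_rep s : Prop :=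
  (exists (a : A) (x : rep_space s), s a x <> 0) /\
  (forall M : set (rep_space s), closed_subspace M ->
     (forall (a : A) (x : rep_space s), M x -> M (s a x)) ->
     M = [set 0] \/ M = setT).

Definition rep_ker s : set A := [set a | forall x : rep_space s, s a x = 0].

Definition weakly_equiv s t : Prop := rep_ker s = rep_ker t.

Definition unitarily_equiv s t : Prop :=
  exists U : {linear rep_space s -> rep_space t},
    [/\ (forall x y, inner (U x) (U y) = inner x y),
        (forall y, exists x, U x = y)
      & (forall (a : A) (x : rep_space s), U (s a x) = t a (U x))].

Definition rep_class s : rep_set := unitarily_equiv s.

Definition spectrum (c : rep_set) : Prop :=
  exists2 s, irreducible_rep s & c = rep_class s.

Definition not_weak_classes p (c : rep_set) : Prop :=
  spectrum c /\ exists2 s, c = rep_class s & ~ weakly_equiv s p.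

Definition ampliation s n (T : 'M[A]_n) : 'M[boundedOp (rep_space s)]_n :=
  map_mx s T.

(* The supremum of ||s^(n)(T)|| over the classes [s] in W; on an empty W it is
   -oo. *)
Definition sup_class_norm (W : rep_set -> Prop) n (T : 'M[A]_n) : \bar R :=
  ereal_sup [set v | exists2 s, W (rep_class s) &
                     v = mxop_norm (ampliation s T)].

End Representations.

Arguments residually_finite_dim {R} A.

(* Main.v *)
Require Import Defs.
From HB Require Import structures.
From mathcomp Require Import all_boot all_order all_algebra.
From mathcomp Require Import complex.
From mathcomp Require Import all_classical all_reals all_analysis.
From mathcomp Require Import ring lra.

Set Implicit Arguments.
Unset Strict Implicit.
Unset Printing Implicit Defensive.

Import Order.TTheory GRing.Theory Num.Theory.
Import numFieldNormedType.Exports.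

Local Open Scope classical_set_scope.
Local Open Scope ring_scope.

(**
The proof is by contraposition: if [pi] acts on an infinite-dimensional space,
then no finite-dimensional irreducible [sigma] is weakly equivalent to [pi],
because the image of [sigma] is a finite-dimensional algebra through which [pi]
would factor ([weakly_equiv_finite_dim]).  Hence the supremum in the hypothesis
runs over all finite-dimensional irreducible representations at least, and it
remains to see that these already compute the norm of a matrix over [A], that
is, dominate [pi] on it.

Finite-dimensional irreducible representations separate the points of [A]: a
finite-dimensional representation that does not kill a self-adjoint [a] can be
cut down to a proper invariant subspace, or to its orthogonal complement, still
without killing [a], until it is irreducible
([finite_dim_irreps_separating]).

A separating family [F] of representations is isometric
([separating_norm]).  The usual argument uses the continuous functional
calculus: if [b] is self-adjoint of norm one and all [s b] have norm at most
[M < 1], then a function vanishing on [0, M^2] but not at one, applied to [b^2],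
produces a nonzero element that the family kills.  Here the function is
[|t - r| + (t - r)] for some [r] between [M^2] and one.  The absolute value comes
from a square root of [1 - h] for a self-adjoint contraction [h], namely [1 - z]
where [z] is the limit of the iteration [z := (h + z^2) / 2] ([sqrt_one_sub]).
Since [A] may have no unit, all of this takes place among self-adjoint multipliers, the maps [f : A -> A]
with [(f a)^* b = a^* (f b)]; they are automatically linear, and the C*-identity
makes [f |-> sup |f a| / |a|] a norm under which unitaries are isometries.

For matrices, the sharp bound follows from the one for entries.  Put [T_0 = T] and
[T_(k+1) = T_k^* T_k].  If [s T] is bounded by [M] for all [s] in [F], then [s T_k]
is bounded by [M^(2^k)], so by isometry each entry of [T_k] has norm at most
[M^(2^k)], and therefore [pi T_k] is bounded by [n^2 M^(2^k)]; but
[|pi T x|^(2^k) <= |pi T_k x|] for unit vectors [x], and [2^k]-th roots remove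
the constant [n^2] ([separating_mx_norm]).
*)

(** * Deciding linear identities in modules *)

Section LmodNormalization.
Variables (K : fieldType) (V : lmodType K).

(** Syntax of module expressions, so that an identity between them reduces to
    finitely many identities between coefficients, which [field] decides. *)
Inductive lexp :=
| LVar of nat | LZero | LAdd of lexp & lexp | LOpp of lexp | LScale of K & lexp.

Fixpoint leval (env : seq V) (t : lexp) : V :=
  match t with
  | LVar i => nth 0 env i
  | LZero => 0
  | LAdd t u => leval env t + leval env u
  | LOpp t => - leval env t
  | LScale c t => c *: leval env t
  end.

Fixpoint lcoef (t : lexp) (i : nat) : K :=
  match t with
  | LVar j => if eqn i j then 1 else 0
  | LZero => 0
  | LAdd t u => lcoef t i + lcoef u i
  | LOpp t => - lcoef t i
  | LScale c t => c * lcoef t i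
  end.

Lemma leval_coef env t :
  leval env t = \sum_(i < size env) lcoef t i *: nth 0 env i.
Proof.
elim: t => [j||t IHt u IHu|t IHt|c t IHt] /=.
- have [jlt|jge] := ltnP j (size env); last first.
    rewrite nth_default// big1 // => i _.
    by rewrite ?eqnE ltn_eqF ?scale0r // (leq_trans (ltn_ord i)).
  rewrite (bigD1 (Ordinal jlt)) //= ?eqnE eqxx scale1r big1 ?addr0 // => i.
  by rewrite -val_eqE /= ?eqnE => /negbTE ->; rewrite scale0r.
- by rewrite big1 // => i _; rewrite scale0r.
- by rewrite IHt IHu -big_split; apply: eq_bigr => i _; rewrite scalerDl.
- by rewrite IHt -sumrN; apply: eq_bigr => i _; rewrite scaleNr.
- by rewrite IHt scaler_sumr; apply: eq_bigr => i _; rewrite scalerA.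
Qed.

Fixpoint same_coef (n : nat) (t u : lexp) : Prop :=
  if n is m.+1 then lcoef t m = lcoef u m /\ same_coef m t u else True.

Lemma eq_leval env t u :
  same_coef (size env) t u -> leval env t = leval env u.
Proof.
move=> tu; rewrite !leval_coef; apply: eq_bigr => i _; congr (_ *: _).
elim: (size env) i tu => [[]//|n IHn] i /= [tun tu].
have [->//|ni] := eqVneq (i : nat) n.
have i_lt : (i < n)%N by rewrite ltn_neqAle ni -ltnS ltn_ord.
exact: (IHn (Ordinal i_lt)).
Qed.

End LmodNormalization.

(* Reification: atoms are collected in a list and replaced by their index. *)
Ltac lmod_mem x env :=
  lazymatch env with
  | nil => constr:(false)
  | cons x _ => constr:(true)
  | cons _ ?s => lmod_mem x s
  end.
Ltac lmod_index x env :=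
  lazymatch env with
  | cons x _ => constr:(O)
  | cons _ ?s => let n := lmod_index x s in constr:(S n)
  end.
Ltac lmod_env t env :=
  lazymatch t with
  | @GRing.add _ ?a ?b => let env := lmod_env a env in lmod_env b env
  | @GRing.opp _ ?a => lmod_env a env
  | @GRing.scale _ _ _ ?a => lmod_env a env
  | @GRing.zero _ => env
  | _ => lazymatch lmod_mem t env with
         | true => env
         | false => constr:(cons t env)
         end
  end.
Ltac lmod_reify K t env :=
  lazymatch t with
  | @GRing.add _ ?a ?b =>
      let a := lmod_reify K a env in
      let b := lmod_reify K b env in constr:(LAdd a b)
  | @GRing.opp _ ?a => let a := lmod_reify K a env in constr:(LOpp a)
  | @GRing.scale _ _ ?c ?a =>
      let a := lmod_reify K a env in constr:(@LScale K c a)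
  | @GRing.zero _ => constr:(@LZero K)
  | _ => let n := lmod_index t env in constr:(@LVar K n)
  end.
Tactic Notation "lmod" constr(K) constr(V) :=
  lazymatch goal with
  | |- @eq _ ?a ?b =>
      let env := lmod_env a (@nil V) in
      let env := lmod_env b env in
      let ra := lmod_reify K a env in
      let rb := lmod_reify K b env in
      refine (@eq_leval K V env ra rb _);
      cbn [size same_coef lcoef eqn]; repeat split; by field
  end.

(** * Complex scalars and real-valued norms *)

Section Scalars.
Variable R : realType.
Implicit Types (r : R) (u v : R[i]).

Lemma conjcR r : (r%:C%C)^* = r%:C%C :> R[i].
Proof. exact: conjc_real. Qed.
Lemma conjci : ('i%C : R[i])^* = - 'i%C.
Proof. by rewrite complexiE conjCi. Qed.
Lemma ReD u v : complex.Re (u + v) = complex.Re u + complex.Re v.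
Proof. by case: u; case: v. Qed.
Lemma ReN u : complex.Re (- u) = - complex.Re u.
Proof. by case: u. Qed.
Lemma ReZ r u : complex.Re (r%:C%C * u) = r * complex.Re u.
Proof. by case: u => u v; rewrite /= mul0r subr0. Qed.
Lemma ReJ u : complex.Re (u^*) = complex.Re u.
Proof. by case: u. Qed.

End Scalars.

Section RealNorm.
Variables (R : realType) (V : normedModType R[i]).
Implicit Types x y : V.

Lemma rnormE x : (rnorm x)%:C%C = `|x|.
Proof. by rewrite /rnorm RRe_real// realE normr_ge0. Qed.
Lemma rnorm_ge0 x : 0 <= rnorm x.
Proof. by rewrite -lecR rnormE normr_ge0. Qed.
Lemma ler_rnormD x y : rnorm (x + y) <= rnorm x + rnorm y.
Proof. by rewrite -lecR rmorphD /= !rnormE ler_normD. Qed.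
Lemma rnormN x : rnorm (- x) = rnorm x.
Proof. by rewrite /rnorm normrN. Qed.
Lemma rnormB x y : rnorm (x - y) = rnorm (y - x).
Proof. by rewrite -rnormN opprB. Qed.
Lemma ler_rnormB x y : rnorm (x - y) <= rnorm x + rnorm y.
Proof. by rewrite (le_trans (ler_rnormD _ _))// rnormN. Qed.
Lemma rnorm0 : rnorm (0 : V) = 0.
Proof. by rewrite /rnorm normr0. Qed.
Lemma rnorm0_eq0 x : rnorm x = 0 -> x = 0.
Proof. by move=> h; apply/normr0_eq0; rewrite -rnormE h. Qed.
Lemma rnormZ (c : R[i]) x : rnorm (c *: x) = complex.Re `|c| * rnorm x.
Proof.
by apply: complexI; rewrite rmorphM/= !rnormE normrZ; congr (_ * _).
Qed.
Lemma rnormZr (c : R) x : rnorm (c%:C%C *: x) = `|c| * rnorm x.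
Proof. by rewrite rnormZ normc_def/= expr0n /= addr0 sqrtr_sqr. Qed.
Lemma rnorm_half x : rnorm (2^-1%:C%C *: x) = 2^-1 * rnorm x.
Proof. by rewrite rnormZr ger0_norm // invr_ge0. Qed.

End RealNorm.

Section Completeness.
Variables (R : realType) (U : completeNormedModType R[i]).

(** Convergence with an explicit rate: limits below are only used through the
    bound on their distance to the approximations. *)
Lemma cauchy_rate_cvg (u : nat -> U) (s : nat -> R) :
  (forall e, 0 < e -> exists n, s n < e) ->
  (forall n m, (n <= m)%N -> rnorm (u m - u n) <= s n) ->
  exists l, forall n, rnorm (l - u n) <= s n.
Proof.
move=> s0 us.
have : cvg (u @ \oo).
  apply: cauchy_cvg; apply: cauchy_exP => e e0.
  have [n sn] : exists n, s n < complex.Re e.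
    by apply: s0; move: e0; rewrite ltcE => /andP[_].
  exists (u n); exists n => // m /= nm.
  rewrite -ball_normE /= -rnormE.
  rewrite -[e]RRe_real ?gtr0_real // ltcR rnormB (le_lt_trans _ sn) //.
  exact: us.
move=> /cvg_ex[l ul]; exists l => n.
apply/ler_addgt0Pr => e e0.
have /cvgrPdist_lt/(_ e%:C%C) := ul.
rewrite ltcR => /(_ e0)[N _ hN].
have := hN (maxn N n) (leq_maxl _ _).
rewrite -rnormE ltcR /= => /ltW h1.
have := us n (maxn N n) (leq_maxr _ _) => h2.
have := ler_rnormD (l - u (maxn N n)) (u (maxn N n) - u n).
by rewrite addrA subrK; lra.
Qed.

End Completeness.

(** * Self-adjoint multipliers *)

Section Form.
Variables (R : realType) (A : cstarAlgType R).
Implicit Types (a b c : A) (f g h : A -> A).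

(** The algebra-valued inner product that makes [A] a Hilbert module over
    itself; it plays for multipliers the role that [inner] plays for operators. *)
Definition cform a b : A := cmul (cstar a) b.

Lemma cformDl a b c : cform (a + b) c = cform a c + cform b c.
Proof. by rewrite /cform cstarD linearDl. Qed.
Lemma cformDr a b c : cform c (a + b) = cform c a + cform c b.
Proof. by rewrite /cform linearDr. Qed.
Lemma cformZl (z : R[i]) a b : cform (z *: a) b = z^* *: cform a b.
Proof. by rewrite /cform cstarZ linearZl_LR. Qed.
Lemma cformZr (z : R[i]) a b : cform a (z *: b) = z *: cform a b.
Proof. by rewrite /cform linearZr_LR. Qed.
Lemma cformRl (r : R) a b : cform (r%:C%C *: a) b = r%:C%C *: cform a b.
Proof. by rewrite cformZl conjcR. Qed.
Lemma cformNl a b : cform (- a) b = - cform a b.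
Proof. by rewrite -scaleN1r cformZl rmorphN rmorph1 scaleN1r. Qed.
Lemma cformNr a b : cform a (- b) = - cform a b.
Proof. by rewrite -scaleN1r cformZr scaleN1r. Qed.
Lemma cformBl a b c : cform (a - b) c = cform a c - cform b c.
Proof. by rewrite cformDl cformNl. Qed.
Lemma cformBr a b c : cform c (a - b) = cform c a - cform c b.
Proof. by rewrite cformDr cformNr. Qed.

Lemma rnorm_cmul a b : rnorm (cmul a b) <= rnorm a * rnorm b.
Proof. by rewrite -lecR rmorphM /= !rnormE cnormM. Qed.
Lemma rnorm_cform_diag a : rnorm (cform a a) = rnorm a ^+ 2.
Proof. by apply: complexI; rewrite rmorphXn /= !rnormE cnorm_star. Qed.
Lemma rnorm_cstar a : rnorm (cstar a) = rnorm a.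
Proof.
suff le b : rnorm b <= rnorm (cstar b).
  by apply/eqP; rewrite eq_le le -{2}(cstarK a) le.
have [->|b0] := eqVneq (rnorm b) 0; first exact: rnorm_ge0.
have b_gt0 : 0 < rnorm b by rewrite lt_def b0 rnorm_ge0.
rewrite -(ler_pM2r b_gt0) -expr2 -rnorm_cform_diag.
exact: rnorm_cmul.
Qed.
Lemma rnorm_cform a b : rnorm (cform a b) <= rnorm a * rnorm b.
Proof. by rewrite (le_trans (rnorm_cmul _ _)) // rnorm_cstar. Qed.

Lemma cform_eq0 a : (forall c, cform c a = 0) -> a = 0.
Proof.
move=> /(_ a) aa; apply: rnorm0_eq0; apply/eqP.
by rewrite -sqrf_eq0 -rnorm_cform_diag aa rnorm0.
Qed.

(** These act as the self-adjoint elements of the unital multiplier algebra,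
    which replaces a unit of [A]. *)
Definition sa_mult f := forall a b, cform (f a) b = cform a (f b).
Definition op_le (m : R) f := forall a, rnorm (f a) <= m * rnorm a.

(** Adjoints determine a multiplier, so linearity on one side of the form
    transfers to the other. *)
Lemma sa_linear f : sa_mult f ->
  forall (z : R[i]) a b, f (z *: a + b) = z *: f a + f b.
Proof.
move=> fsa z a b; apply/eqP; rewrite -subr_eq0; apply/eqP/cform_eq0 => c.
by rewrite !(cformBr, cformDr, cformZr, =^~ fsa) subrr.
Qed.
Lemma saD f : sa_mult f -> {morph f : a b / a + b}.
Proof. by move=> fsa a b; have := sa_linear fsa 1 a b; rewrite !scale1r. Qed.
Lemma sa0 f : sa_mult f -> f 0 = 0.
Proof. by move=> fsa; apply: (addrI (f 0)); rewrite -saD // !addr0. Qed.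
Lemma saZ f : sa_mult f -> forall (z : R[i]) a, f (z *: a) = z *: f a.
Proof. by move=> fsa z a; have := sa_linear fsa z a 0; rewrite !addr0 sa0// addr0. Qed.
Lemma saN f : sa_mult f -> {morph f : a / - a}.
Proof. by move=> fsa a; rewrite -scaleN1r saZ // scaleN1r. Qed.
Lemma saB f : sa_mult f -> {morph f : a b / a - b}.
Proof. by move=> fsa a b; rewrite saD // saN. Qed.

Lemma sa_id : sa_mult id. Proof. by []. Qed.
Lemma sa_comp f g : sa_mult f -> sa_mult g ->
  (forall a, f (g a) = g (f a)) -> sa_mult (f \o g).
Proof. by move=> fsa gsa fg a b /=; rewrite fsa gsa fg. Qed.
Lemma sa_sqr f : sa_mult f -> sa_mult (fun a => f (f a)).
Proof. by move=> fsa a b; rewrite !fsa. Qed.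
Lemma saBf f g : sa_mult f -> sa_mult g -> sa_mult (fun a => f a - g a).
Proof. by move=> fsa gsa a b; rewrite cformBl cformBr fsa gsa. Qed.
Lemma saDf f g : sa_mult f -> sa_mult g -> sa_mult (fun a => f a + g a).
Proof. by move=> fsa gsa a b; rewrite cformDl cformDr fsa gsa. Qed.
Lemma saZf (r : R) f : sa_mult f -> sa_mult (fun a => r%:C%C *: f a).
Proof. by move=> fsa a b; rewrite cformRl cformZr fsa. Qed.

(** The C*-identity for multipliers: [(f a)^* (f a) = a^* (f (f a))]. *)
Lemma op_le_of_sqr m f : 0 <= m -> sa_mult f -> op_le (m ^+ 2) (fun a => f (f a)) ->
  op_le m f.
Proof.
move=> m0 fsa f2 a.
rewrite -(ler_pXn2r (ltn0Sn 1)) ?nnegrE ?mulr_ge0 ?rnorm_ge0 //.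
rewrite -rnorm_cform_diag fsa (le_trans (rnorm_cform _ _))//.
have := f2 a; have := rnorm_ge0 a; nra.
Qed.

(** The scalar case [h = 1] of the square root iteration: it increases to one,
    and its steps bound the steps of the operator iteration. *)
Fixpoint sqrt_rate (n : nat) : R :=
  if n is m.+1 then (1 + sqrt_rate m ^+ 2) / 2 else 0.

(** [1 - t] turns into [(1 - t) - (1 - t)^2 / 2], which decays like [2 / n]. *)
Lemma sqrt_rate_bound n : 0 <= sqrt_rate n /\ 1 - 2 / (n.+2)%:R <= sqrt_rate n <= 1.
Proof.
elim: n => [|n [t0 /andP[t1 t2]]] /=; first by split => //; lra.
have n0 : (0 : R) <= n%:R by rewrite ler0n.
have -> : (n.+3)%:R = n%:R + 3 :> R by rewrite -addn3 natrD.
have E : (n.+2)%:R = n%:R + 2 :> R by rewrite -addn2 natrD.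
rewrite E in t1.
split; first by nra.
apply/andP; split; last by nra.
set x := n%:R in n0 t1 *.
have h0 : 0 < 2 / (x + 2) by rewrite divr_gt0//; lra.
have h1 : 2 / (x + 2) <= 1 by rewrite ler_pdivrMr; lra.
have h2 : 2 / (x + 2) - (2 / (x + 2))^+2 / 2 <= 2 / (x + 3).
  rewrite -subr_ge0.
  have -> : 2 / (x + 3) - (2 / (x + 2) - (2 / (x + 2)) ^+ 2 / 2) =
    2 / ((x + 3) * (x + 2) ^+ 2) by field; apply/andP; split; apply/eqP; lra.
  by apply: divr_ge0 => //; nra.
have : (1 - 2 / (x+2))^+2 <= sqrt_rate n ^+ 2 by rewrite ler_pXn2r // nnegrE; lra.
nra.
Qed.

Lemma le0_of_sqrt_rate (C : R) (x : R) : (forall n, x <= C * (1 - sqrt_rate n)) -> x <= 0.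
Proof.
move=> h; rewrite leNgt; apply/negP => x0.
have C0 : 0 < C by have := h 0 => /=; lra.
have [n hn] : exists n : nat, 2 * C / x < n%:R.
  exists (Num.trunc (2 * C / x)).+1.
  exact: truncnS_gt.
have n0 : 0 < n%:R :> R by apply: le_lt_trans hn; rewrite divr_ge0; lra.
have [_ /andP[+ _]] := sqrt_rate_bound n.
have : 2 / n.+2%:R <= 2 / n%:R :> R.
  have n_gt0 : (0 < n)%N by move: n0; rewrite ltr0n.
  rewrite ler_pM2l // lef_pV2 ?posrE ?ltr0n // ler_nat.
  exact: leqW (leqnSn n).
have : 2 / n%:R < x / C.
  by rewrite ltr_pdivrMr // mulrAC ltr_pdivlMr //; move: hn; rewrite ltr_pdivrMr //; lra.
have : x / C <= 1 - sqrt_rate n by rewrite ler_pdivrMr // mulrC.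
move: (2 / n.+2%:R) (2 / n%:R) (x / C) (sqrt_rate n) => a b c t; lra.
Qed.

Section SquareRoot.
Variable h : A -> A.
Hypotheses (hsa : sa_mult h) (h1 : op_le 1 h).

(** Iterates of [z := (h + z^2) / 2], whose fixed point [z] satisfies
    [(1 - z)^2 = 1 - h]. *)
Fixpoint sqrt_iter (n : nat) (a : A) : A :=
  if n is m.+1 then 2^-1%:C%C *: (h a + sqrt_iter m (sqrt_iter m a)) else 0.

Lemma sqrt_iter_sa n : sa_mult (sqrt_iter n).
Proof.
elim: n => [|n IHn] /=.
  by move=> a b; rewrite -(scale0r a) cformZl cformZr rmorph0 !scale0r.
exact/saZf/saDf/sa_sqr.
Qed.

Lemma sqrt_iter_comm n g : sa_mult g -> (forall a, g (h a) = h (g a)) ->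
  forall a, g (sqrt_iter n a) = sqrt_iter n (g a).
Proof.
move=> gsa gh; elim: n => [|n IHn] a /=; first exact: sa0.
by rewrite saZ // saD // gh !IHn.
Qed.

Lemma sqrt_iter_le n : op_le (sqrt_rate n) (sqrt_iter n).
Proof.
elim: n => [|n IHn] a /=; first by rewrite rnorm0 mul0r.
rewrite rnorm_half.
have := ler_rnormD (h a) (sqrt_iter n (sqrt_iter n a)).
have := h1 a; have := IHn a; have := IHn (sqrt_iter n a).
have [t0 _] := sqrt_rate_bound n; have := rnorm_ge0 a.
nra.
Qed.

(** With [d = u - v] for consecutive iterates, [u^2 - v^2 = d u + v d], so norms
    obey the recursion of the scalar steps. *)
Lemma sqrt_iter_step n :
  op_le (sqrt_rate n.+1 - sqrt_rate n) (fun a => sqrt_iter n.+1 a - sqrt_iter n a).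
Proof.
elim: n => [|n IHn] a.
  by have := h1 a; rewrite /= !subr0 rnorm_half addr0; lra.
set u := sqrt_iter n.+1; set v := sqrt_iter n.
have -> : sqrt_iter n.+2 a - u a =
    2^-1%:C%C *: ((u (u a) - v (u a)) + v (u a - v a)).
  rewrite (saB (sqrt_iter_sa n : sa_mult v)) addrA subrK.
  rewrite [sqrt_iter n.+2 a]/= -/u [u a in LHS]/= -/v.
  rewrite -scalerBr; congr (_ *: _).
  by rewrite opprD addrACA subrr add0r.
rewrite rnorm_half.
have := ler_rnormD (u (u a) - v (u a)) (v (u a - v a)).
have := IHn (u a); have := IHn a; have := sqrt_iter_le n (u a - v a).
have := sqrt_iter_le n.+1 a.
rewrite -/u -/v.
have [t0 _] := sqrt_rate_bound n; have [t1 _] := sqrt_rate_bound n.+1.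
have -> : sqrt_rate n.+2 - sqrt_rate n.+1 = (sqrt_rate n.+1 ^+ 2 - sqrt_rate n ^+ 2) / 2.
  have E k : sqrt_rate k.+1 = (1 + sqrt_rate k ^+ 2) / 2 by [].
  rewrite (E n.+1) [X in _ - X](E n); move: (sqrt_rate n) (sqrt_rate n.+1) => t t'.
  by field.
have := rnorm_ge0 a; have := rnorm_ge0 (u a).
have : sqrt_rate n <= sqrt_rate n.+1 by have := sqr_ge0 (1 - sqrt_rate n); rewrite /= !expr2; lra.
set t := sqrt_rate n in t0 *; set t' := sqrt_rate n.+1 in t1 *.
move=> tt' ua0 a0 ua h2 h3 h4 h5.
have h6 : (t' - t) * rnorm (u a) <= (t' - t) * (t' * rnorm a) by apply: ler_wpM2l => //; lra.
have h7 : t * rnorm (u a - v a) <= t * ((t' - t) * rnorm a) by apply: ler_wpM2l.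
lra.
Qed.

Lemma sqrt_iter_cauchy n m a : (n <= m)%N ->
  rnorm (sqrt_iter m a - sqrt_iter n a) <= (1 - sqrt_rate n) * rnorm a.
Proof.
move=> nm.
have : rnorm (sqrt_iter m a - sqrt_iter n a) <= (sqrt_rate m - sqrt_rate n) * rnorm a.
  rewrite -(subnKC nm); elim: (m - n)%N => [|k IHk].
    by rewrite addn0 !subrr rnorm0 mul0r.
  rewrite addnS.
  have := sqrt_iter_step (n + k) a.
  have := ler_rnormD (sqrt_iter (n + k).+1 a - sqrt_iter (n + k) a)
    (sqrt_iter (n + k) a - sqrt_iter n a).
  by rewrite addrA subrK; lra.
have [_ /andP[_ t1]] := sqrt_rate_bound m.
by have := rnorm_ge0 a; nra.
Qed.

(** A positive square root of [1 - h].  The bound on [1 - y] is what lets the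
    construction be iterated, and the commutation clause is what functional
    calculus would give. *)
Lemma sqrt_one_sub : exists y : A -> A,
  [/\ sa_mult y, op_le 1 (fun a => a - y a), (forall a, y (y a) = a - h a)
    & forall g m, sa_mult g -> op_le m g -> (forall a, g (h a) = h (g a)) ->
        forall a, g (y a) = y (g a)].
Proof.
have lim a : exists l, forall n, rnorm (l - sqrt_iter n a) <= (1 - sqrt_rate n) * rnorm a.
  apply: cauchy_rate_cvg; last by move=> n m; exact: sqrt_iter_cauchy.
  move=> e e0; apply: contrapT => /forallNP he.
  have : e <= 0; last by rewrite leNgt e0.
  apply: (@le0_of_sqrt_rate (rnorm a)) => n.
  by rewrite leNgt mulrC; apply/negP/he.
have [z zE] := choice lim.
have t01 n : 0 <= sqrt_rate n <= 1.
  by have [-> /andP[_ ->]] := sqrt_rate_bound n.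
have zlim (P : A) C : 0 <= C -> (forall n, rnorm P <= C * (1 - sqrt_rate n)) -> P = 0.
  move=> C0 /le0_of_sqrt_rate P0; apply: rnorm0_eq0; apply/eqP.
  by rewrite eq_le P0 rnorm_ge0.
have zsa : sa_mult z.
  move=> a b; apply/eqP; rewrite -subr_eq0; apply/eqP.
  apply: (zlim _ (2 * (rnorm a * rnorm b))) => [|n].
    by rewrite !mulr_ge0 ?rnorm_ge0.
  have -> : cform (z a) b - cform a (z b) =
      cform (z a - sqrt_iter n a) b - cform a (z b - sqrt_iter n b).
    by rewrite cformBl cformBr (sqrt_iter_sa n) opprB addrA subrK.
  apply: le_trans (ler_rnormB _ _) _.
  have := rnorm_cform (z a - sqrt_iter n a) b.
  have := rnorm_cform a (z b - sqrt_iter n b).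
  have := zE a n; have := zE b n; have := rnorm_ge0 a; have := rnorm_ge0 b.
  nra.
have z1 : op_le 1 z.
  by move=> a; have := zE a 0 => /=; rewrite !subr0.
have zz a : z (z a) = 2%:C%C *: z a - h a.
  apply/eqP; rewrite -subr_eq0; apply/eqP.
  apply: (zlim _ (4 * rnorm a)) => [|n]; first by rewrite mulr_ge0 ?rnorm_ge0.
  have -> : z (z a) - (2%:C%C *: z a - h a) =
     (z (z a) - sqrt_iter n (z a)) + sqrt_iter n (z a - sqrt_iter n a)
     - 2%:C%C *: (z a - sqrt_iter n.+1 a).
    rewrite (saB (sqrt_iter_sa n)) [sqrt_iter n.+1 a]/=.
    set p := sqrt_iter n (z a); set q := sqrt_iter n (sqrt_iter n a).
    lmod R[i] A.
  apply: le_trans (ler_rnormB _ _) _; rewrite rnormZr ger0_norm //.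
  have := ler_rnormD (z (z a) - sqrt_iter n (z a)) (sqrt_iter n (z a - sqrt_iter n a)).
  have := zE (z a) n; have := z1 a; have := sqrt_iter_le n (z a - sqrt_iter n a).
  have := zE a n; have := zE a n.+1 => /=.
  have := t01 n; have := rnorm_ge0 a; have := rnorm_ge0 (z a).
  have := rnorm_ge0 (z a - sqrt_iter n a).
  set t := sqrt_rate n.
  move=> ha hb hc /andP[t0 t1] e1 e2 e3 e4 e5 e6.
  have : t * rnorm (z a - sqrt_iter n a) <= rnorm (z a - sqrt_iter n a) by nra.
  have : (1 - t) * rnorm (z a) <= (1 - t) * rnorm a.
    by apply: ler_wpM2l; lra.
  have : (1 - t) ^+ 2 * rnorm a >= 0 by rewrite mulr_ge0 // sqr_ge0.
  lra.
exists (fun a => a - z a); split.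
- exact: saBf sa_id zsa.
- by move=> a; rewrite opprB addrC subrK.
- move=> a; rewrite (saB zsa) zz.
  lmod R[i] A.
- move=> g m gsa gm gh a; rewrite (saB gsa); congr (_ - _).
  apply/eqP; rewrite -subr_eq0; apply/eqP.
  apply: (zlim _ (`|m| * rnorm a + rnorm (g a))) => [|n].
    by rewrite addr_ge0 ?mulr_ge0 ?rnorm_ge0.
  have -> : g (z a) - z (g a) = g (z a - sqrt_iter n a) - (z (g a) - sqrt_iter n (g a)).
    by rewrite (saB gsa) (sqrt_iter_comm _ gsa gh) opprB addrA subrK.
  apply: le_trans (ler_rnormB _ _) _.
  have := gm (z a - sqrt_iter n a); have := zE a n; have := zE (g a) n.
  have : m <= `|m| by exact: ler_norm.
  have := rnorm_ge0 (z a - sqrt_iter n a).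
  have := normr_ge0 m.
  set X := rnorm (z a - _).
  move=> m0 X0 mm e1 e2 e3.
  have : m * X <= `|m| * X by apply: ler_wpM2r.
  have : `|m| * X <= `|m| * ((1 - sqrt_rate n) * rnorm a) by apply: ler_wpM2l.
  lra.
Qed.

End SquareRoot.

End Form.

(** * Contractions and absolute values of multipliers *)

Section Contractions.
Variables (R : realType) (A : cstarAlgType R).
Implicit Types (a b c : A) (f g h p q d : A -> A).

(** [p + i q] is unitary. *)
Lemma sqr_one_isometry p q : sa_mult p -> sa_mult q ->
  (forall a, p (q a) = q (p a)) -> (forall a, p (p a) + q (q a) = a) ->
  forall a, rnorm (p a + 'i%C *: q a) = rnorm a.
Proof.
move=> psa qsa pq pq1 a; apply/eqP.
rewrite -(eqrXn2 (n := 2)) ?rnorm_ge0 // -!rnorm_cform_diag; apply/eqP; congr rnorm.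
rewrite cformDl !cformDr !(cformZl, cformZr) conjci !psa !qsa -pq scalerA.
rewrite mulNr -expr2 sqr_i opprK scale1r scaleNr addrACA addrA.
by rewrite subrK -cformDr pq1.
Qed.

(** [p] is the mean of the unitaries [p + i q] and [p - i q]. *)
Lemma op_le1_cos p q : sa_mult p -> sa_mult q ->
  (forall a, p (q a) = q (p a)) -> (forall a, p (p a) + q (q a) = a) ->
  op_le 1 p.
Proof.
move=> psa qsa pq pq1 a.
have nqsa : sa_mult (fun a => - q a).
  by move=> b c; rewrite cformNl cformNr qsa.
have e1 := sqr_one_isometry psa qsa pq pq1 a.
have e2 : rnorm (p a + 'i%C *: (- q a)) = rnorm a.
  apply: (sqr_one_isometry psa nqsa) => b; first by rewrite saN // pq.
  by rewrite (saN qsa) opprK.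
have : rnorm (2%:C%C *: p a) <= rnorm a + rnorm a.
  rewrite -{1}e1 -e2; apply: le_trans (ler_rnormD _ _).
  rewrite le_eqVlt; apply/orP; left; apply/eqP; congr rnorm.
  lmod R[i] A.
by rewrite rnormZr ger0_norm //; lra.
Qed.

(** With [f = sin t] this is [cos (2 t)], the corresponding sine being
    [2 f sqrt (1 - f^2)].  It expresses that [f^2] lies between zero and one, as
    a bound on norms. *)
Lemma op_le1_double_angle f : sa_mult f -> op_le 1 f ->
  op_le 1 (fun a => a - 2%:C%C *: f (f a)).
Proof.
move=> fsa f1; have f2sa := sa_sqr fsa.
have f21 : op_le 1 (fun a => f (f a)).
  by move=> a; apply: le_trans (f1 _) _; rewrite !mul1r; have := f1 a; rewrite mul1r.
have [y [ysa _ yy yc]] := sqrt_one_sub f2sa f21.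
have {}yc a : f (y a) = y (f a) by exact: (yc f 1).
pose p a := a - 2%:C%C *: f (f a); pose q a := 2%:C%C *: f (y a).
have psa : sa_mult p by exact/(saBf (@sa_id _ _))/saZf.
have qsa : sa_mult q by apply/saZf/(sa_comp fsa ysa).
apply: (op_le1_cos psa qsa) => a; rewrite /p /q.
  rewrite !(saZ fsa, saZ ysa, saB fsa, saB ysa) -!yc.
  lmod R[i] A.
rewrite !(saZ fsa, saZ ysa, saB fsa, saB ysa) -!yc yy !(saB fsa).
lmod R[i] A.
Qed.

(** [y^2] is the absolute value of [d]: the bound on [1 - 2 d^2] shows that
    [1 - d^2] is a contraction, so [d^2] has a square root [e] with [1 - e] a
    contraction, so [e] has a square root in turn. *)
Lemma absolute_value d : sa_mult d -> op_le 1 d ->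
  exists y, [/\ sa_mult y, forall a, y (y (y (y a))) = d (d a)
              & forall a, d (y a) = y (d a)].
Proof.
move=> dsa d1; have d2sa := sa_sqr dsa.
pose h a := a - d (d a).
have hsa : sa_mult h by exact: saBf (@sa_id _ _) d2sa.
have h1 : op_le 1 h.
  move=> a.
  have -> : h a = 2^-1%:C%C *: (a + (a - 2%:C%C *: d (d a))).
    by rewrite /h; lmod R[i] A.
  rewrite rnorm_half.
  have := ler_rnormD a (a - 2%:C%C *: d (d a)).
  have := op_le1_double_angle dsa d1 a; lra.
have [e [esa e1 ee ec]] := sqrt_one_sub hsa h1.
have {}ec a : d (e a) = e (d a).
  by apply: (ec d 1) => // b; rewrite /h saB.
pose k a := a - e a.
have ksa : sa_mult k by exact: saBf (@sa_id _ _) esa.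
have [y [ysa _ yy yc]] := sqrt_one_sub ksa e1.
have yyE a : y (y a) = e a by rewrite yy /k opprB addrC subrK.
exists y; split => // a.
  by rewrite !yyE ee /h opprB addrC subrK.
by apply: (yc d 1) => // b; rewrite /k saB // ec.
Qed.

End Contractions.

(** * Norms of elements under representations *)

Section RealInner.
Variables (R : realType) (H : hilbertType R).
Implicit Types x y z : H.

(** The real part carries the norm and is a real symmetric bilinear form. *)
Definition rinner x y : R := complex.Re (inner x y).

Lemma rinnerDl x y z : rinner (x + y) z = rinner x z + rinner y z.
Proof. by rewrite /rinner linearDl ReD. Qed.
Lemma rinnerC x y : rinner x y = rinner y x.
Proof.
by rewrite /rinner hermC expr0 mul1r ReJ.
Qed.
Lemma rinnerZl (r : R) x y : rinner (r%:C%C *: x) y = r * rinner x y.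
Proof.
by rewrite /rinner linearZl_LR ReZ.
Qed.
Lemma rinnerNl x y : rinner (- x) y = - rinner x y.
Proof. by rewrite /rinner linearNl ReN. Qed.
Lemma rinnerBl x y z : rinner (x - y) z = rinner x z - rinner y z.
Proof. by rewrite rinnerDl rinnerNl. Qed.
Lemma rinnerBr x y z : rinner z (x - y) = rinner z x - rinner z y.
Proof. by rewrite !(rinnerC z) rinnerBl. Qed.
Lemma rinnerZr (r : R) x y : rinner x (r%:C%C *: y) = r * rinner x y.
Proof. by rewrite !(rinnerC x) rinnerZl. Qed.
Lemma rinner_diag x : rinner x x = rnorm x ^+ 2.
Proof. by rewrite /rinner inner_norm -rnormE -rmorphXn. Qed.

Lemma rinner_le x y : rinner x y <= rnorm x * rnorm y.
Proof.
have [x0|x0] := eqVneq (rnorm x) 0.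
  rewrite (rnorm0_eq0 x0) -[in leLHS](scale0r x) -[0 in leLHS](rmorph0 (real_complex R)).
  by rewrite rinnerZl mul0r rnorm0 mul0r.
have [y0|y0] := eqVneq (rnorm y) 0.
  rewrite (rnorm0_eq0 y0) -[in leLHS](scale0r y) -[0 in leLHS](rmorph0 (real_complex R)).
  by rewrite rinnerZr mul0r rnorm0 mulr0.
have xp : 0 < rnorm x by rewrite lt_def x0 rnorm_ge0.
have yp : 0 < rnorm y by rewrite lt_def y0 rnorm_ge0.
have : 0 <= rinner ((rnorm y)%:C%C *: x - (rnorm x)%:C%C *: y)
                   ((rnorm y)%:C%C *: x - (rnorm x)%:C%C *: y).
  by rewrite rinner_diag sqr_ge0.
rewrite !(rinnerBl, rinnerBr, rinnerZl, rinnerZr) (rinnerC y x) !rinner_diag => h.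
have : 0 <= (rnorm x * rnorm y) * (rnorm x * rnorm y - rinner x y) by nra.
by rewrite pmulr_rge0 ?mulr_gt0 // subr_ge0.
Qed.

End RealInner.

Section Reps.
Variables (R : realType) (A : cstarAlgType R).
Implicit Types (a b c : A) (s t : starRep A).

Lemma repD s a b (x : rep_space s) : s (a + b) x = s a x + s b x.
Proof. by rewrite -[a]scale1r rep_linear !scale1r. Qed.
Lemma rep0 s (x : rep_space s) : s 0 x = 0.
Proof. by apply: (addrI (s 0 x)); rewrite -repD !addr0. Qed.
Lemma repZ s (z : R[i]) a (x : rep_space s) : s (z *: a) x = z *: s a x.
Proof. by rewrite -[z *: a]addr0 rep_linear rep0 addr0. Qed.
Lemma repN s a (x : rep_space s) : s (- a) x = - s a x.
Proof. by rewrite -scaleN1r repZ scaleN1r. Qed.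
Lemma repB s a b (x : rep_space s) : s (a - b) x = s a x - s b x.
Proof. by rewrite repD repN. Qed.

Lemma rinner_rep s a (x y : rep_space s) : rinner (s a x) y = rinner x (s (cstar a) y).
Proof. by rewrite /rinner rep_star. Qed.
Lemma rinner_cform s a b (x y : rep_space s) :
  rinner (s (cform a b) x) y = rinner (s b x) (s a y).
Proof. by rewrite /cform rep_mul rinner_rep cstarK. Qed.

Definition separating (F : rep_set A) :=
  forall a, (forall s, F s -> forall x, s a x = 0) -> a = 0.

Lemma mult_sa b : cstar b = b -> sa_mult (cmul b).
Proof. by move=> bsa a c; rewrite /cform cstarM bsa cmulA. Qed.
Lemma mult_le b : op_le (rnorm b) (cmul b).
Proof. by move=> a; exact: rnorm_cmul. Qed.

(** Let [d = b^2 - r] with [M^2 < r < 1], negative under every [s] in [F].  The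
    element [(|d| + d) c] is then killed by all of [F], hence zero, so that
    [r - b^2 = |d|] is positive.  With [b^2] positive as well, this forces
    [|b^2| <= r], against [|b| = 1]. *)
Lemma separating_norm_lt1 (F : rep_set A) b (M : R) : separating F ->
  cstar b = b -> rnorm b = 1 -> 0 <= M -> M < 1 ->
  (forall s, F s -> forall x, rnorm (s b x) <= M * rnorm x) -> False.
Proof.
move=> Fsep bsa b1 M0 M1 FM.
pose r : R := (1 + M ^+ 2) / 2.
have r_lt1 : r < 1 by rewrite /r; nra.
have Mr : M ^+ 2 < r by rewrite /r; nra.
have r_ge : 2^-1 <= r by rewrite /r; nra.
clearbody r.
have fsa := mult_sa bsa.
have f1 : op_le 1 (cmul b) by rewrite -b1; exact: mult_le.
set f := cmul b in fsa f1 *.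
pose d a := f (f a) - r%:C%C *: a.
have dsa : sa_mult d by exact/(saBf (sa_sqr fsa))/saZf/sa_id.
have dr : op_le r d.
  move=> a.
  have -> : d a = - (2^-1%:C%C *: (a - 2%:C%C *: f (f a)) + (r - 2^-1)%:C%C *: a).
    by rewrite /d; lmod R[i] A.
  rewrite rnormN; apply: le_trans (ler_rnormD _ _) _.
  rewrite rnorm_half rnormZr ger0_norm ?subr_ge0 //.
  by have := op_le1_double_angle fsa f1 a; lra.
have d1 : op_le 1 d.
  by move=> a; have := dr a; have := rnorm_ge0 a; nra.
have [y [ysa yyyy dy]] := absolute_value dsa d1.
have yy c : y (y c) = - d c.
  apply/eqP; rewrite -addr_eq0; apply/eqP; set w := y (y c) + d c.
  have yyw : y (y w) = d w.
    rewrite /w (saD ysa _ (d c)) (saD ysa _ (y (d c))) (saD dsa _ (d c)).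
    by rewrite yyyy !dy addrC.
  apply: Fsep => s Fs x; apply: rnorm0_eq0.
  set v := s w x.
  (* [w^* |d| w] is positive because [|d| = y^2], while [w^* d w] is negative in
     the representation [s]; the two agree. *)
  have e1 : 0 <= rinner (s (cform w (d w)) x) x.
    by rewrite -yyw -ysa rinner_cform rinner_diag sqr_ge0.
  move: e1; rewrite rinner_cform -/v repB repZ !rep_mul -/v rinnerBl rinnerZl.
  rewrite rinner_rep bsa !rinner_diag.
  have := FM s Fs v; have := rnorm_ge0 (s b v); have := rnorm_ge0 v.
  set n := rnorm v; set m := rnorm (s b v) => n0 m0 mn h.
  have : m ^+ 2 <= (M * n) ^+ 2 by rewrite ler_pXn2r // nnegrE mulr_ge0.
  rewrite exprMn => h2.
  have n2 : (r - M ^+ 2) * n ^+ 2 <= 0 by lra.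
  have : n ^+ 2 <= 0 by move: n2; rewrite pmulr_rle0 // subr_gt0.
  by move=> n3; apply/eqP; rewrite -sqrf_eq0 eq_le n3 sqr_ge0.
have r_gt0 : 0 < r by lra.
have r_ge0 := ltW r_gt0.
(* [g = y / sqrt r] is a contraction, as [g^2 = (r - b^2) / r] is one. *)
pose q := (Num.sqrt r)^-1.
have qq : q * q = r^-1 by rewrite /q -invfM -expr2 sqr_sqrtr // ltW.
pose g a := q%:C%C *: y a.
have gsa : sa_mult g by exact: saZf.
have gg a : g (g a) = r^-1%:C%C *: y (y a).
  by rewrite /g (saZ ysa) scalerA -rmorphM qq.
have g1 : op_le 1 g.
  apply: op_le_of_sqr => // a; rewrite gg yy rnormZr rnormN ger0_norm ?invr_ge0//.
  by rewrite expr1n mul1r ler_pdivrMl //; exact: dr.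
have key c : rnorm (f (f c)) <= r * rnorm c.
  (* [1 - 2 g^2 = 2 b^2 / r - 1] *)
  have h1 := op_le1_double_angle gsa g1 c.
  have := ler_rnormD (c - 2%:C%C *: g (g c)) c.
  have -> : c - 2%:C%C *: g (g c) + c = (2 / r)%:C%C *: f (f c).
    have -> : (2 / r)%:C%C = 2%:C%C * r^-1%:C%C :> R[i] by rewrite -rmorphM.
    rewrite gg yy /d.
    have : r^-1%:C%C * r%:C%C = 1 :> R[i] by rewrite -rmorphM mulVf ?gt_eqF.
    move: (r^-1%:C%C) (r%:C%C) => u v uv.
    have v0 : v != 0 by apply/eqP => v0; move: uv; rewrite v0 mulr0 => /eqP; rewrite eq_sym oner_eq0.
    have {uv}-> : u = v^-1 by rewrite -[u]mulr1 -(mulfV v0) mulrA uv mul1r.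
    lmod R[i] A.
  rewrite rnormZr ger0_norm ?divr_ge0 // => h2.
  have : 2 / r * rnorm (f (f c)) <= 2 * rnorm c by lra.
  by rewrite mulrAC ler_pdivrMr // => h3; lra.
have bb : rnorm (cmul b b) = 1.
  by rewrite -{1}bsa -/(cform b b) rnorm_cform_diag b1 expr1n.
have := key (cmul b b); rewrite /f cmulA bb mulr1.
have -> : cmul (cmul b b) (cmul b b) = cform (cmul b b) (cmul b b).
  by rewrite /cform cstarM !bsa.
by rewrite rnorm_cform_diag bb expr1n; lra.
Qed.

Lemma rnorm_rep_sqr s a (M : R) : 0 <= M ->
  (forall x, rnorm (s a x) <= M * rnorm x) ->
  forall x, rnorm (s (cform a a) x) <= M ^+ 2 * rnorm x.
Proof.
move=> M0 aM x; set v := s _ x.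
have [->|v0] := eqVneq (rnorm v) 0; first by rewrite mulr_ge0 ?sqr_ge0 ?rnorm_ge0.
have v_gt0 : 0 < rnorm v by rewrite lt_def v0 rnorm_ge0.
rewrite -(ler_pM2r v_gt0) -expr2 -rinner_diag {1}/v rinner_cform.
apply: le_trans (rinner_le _ _) _.
have -> : M ^+ 2 * rnorm x * rnorm v = (M * rnorm x) * (M * rnorm v) by ring.
by apply: ler_pM; rewrite ?rnorm_ge0.
Qed.

Lemma separating_norm_sa (F : rep_set A) b (M : R) : separating F ->
  cstar b = b -> 0 <= M ->
  (forall s, F s -> forall x, rnorm (s b x) <= M * rnorm x) -> rnorm b <= M.
Proof.
move=> Fsep bsa M0 FM; rewrite leNgt; apply/negP => Mb.
have b0 : 0 < rnorm b by apply: le_lt_trans Mb.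
apply: (@separating_norm_lt1 F ((rnorm b)^-1%:C%C *: b) (M / rnorm b)) => //.
- by rewrite cstarZ conjcR bsa.
- by rewrite rnormZr ger0_norm ?invr_ge0 ?rnorm_ge0 // mulVf ?gt_eqF.
- by rewrite divr_ge0 // rnorm_ge0.
- by rewrite ltr_pdivrMr // mul1r.
- move=> s Fs x; rewrite repZ rnormZr ger0_norm ?invr_ge0 ?rnorm_ge0 // mulrC.
  by rewrite mulrAC ler_pM2r ?invr_gt0 // FM.
Qed.

(** The family embeds [A] in a product of operator algebras, and an injective
    morphism of C*-algebras is isometric. *)
Lemma separating_norm (F : rep_set A) a (M : R) : separating F -> 0 <= M ->
  (forall s, F s -> forall x, rnorm (s a x) <= M * rnorm x) -> rnorm a <= M.
Proof.
move=> Fsep M0 FM; rewrite -(ler_pXn2r (ltn0Sn 1)) ?nnegrE ?rnorm_ge0 //.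
rewrite -rnorm_cform_diag; apply: (separating_norm_sa Fsep); rewrite ?sqr_ge0 //.
  by rewrite /cform cstarM cstarK.
by move=> s Fs x; apply: rnorm_rep_sqr => // {}x; exact: FM.
Qed.

(** Without a unit, [1 - k^2] has a square root only as a multiplier [y], which
    the representation does not see; but [k^* (1 - k^2) k = (y k)^* (y k)] is in
    [A], which bounds [s k] on its own range, and Cauchy-Schwarz extends the
    bound to all vectors. *)
Lemma rep_contractive_sa s k (x : rep_space s) : cstar k = k ->
  rnorm k <= 1 -> rnorm (s k x) <= rnorm x.
Proof.
move=> ksa k1.
have msa := mult_sa ksa.
have m1 : op_le 1 (cmul k).
  by move=> a; apply: le_trans (mult_le k a) _; rewrite ler_wpM2r ?rnorm_ge0.
have kk1 : op_le 1 (fun a => cmul k (cmul k a)).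
  by move=> a; apply: le_trans (m1 _) _; rewrite !mul1r; have := m1 a; rewrite mul1r.
have [y [ysa _ yy _]] := sqrt_one_sub (sa_sqr msa) kk1.
have key : rnorm (s k (s k x)) <= rnorm (s k x).
  rewrite -(ler_pXn2r (ltn0Sn 1)) ?nnegrE ?rnorm_ge0 // -subr_ge0.
  have <- : rnorm (s (y k) x) ^+ 2 =
      rnorm (s k x) ^+ 2 - rnorm (s k (s k x)) ^+ 2; last exact: sqr_ge0.
  rewrite -!rinner_diag -rinner_cform ysa yy cformBr repB rinnerBl rinner_cform.
  congr (_ - _).
  by rewrite rinner_cform !rep_mul rinner_rep ksa.
have [->|v0] := eqVneq (rnorm (s k x)) 0; first exact: rnorm_ge0.
have v_gt0 : 0 < rnorm (s k x) by rewrite lt_def v0 rnorm_ge0.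
rewrite -(ler_pM2r v_gt0) -expr2 -rinner_diag rinner_rep ksa.
apply: le_trans (rinner_le _ _) _.
by rewrite ler_wpM2l ?rnorm_ge0.
Qed.

Lemma rep_contractive s a (x : rep_space s) : rnorm (s a x) <= rnorm a * rnorm x.
Proof.
have [/rnorm0_eq0->|a0] := eqVneq (rnorm a) 0.
  by rewrite rep0 !rnorm0 mul0r.
have a_gt0 : 0 < rnorm a by rewrite lt_def a0 rnorm_ge0.
pose k := (rnorm a ^- 2)%:C%C *: cform a a.
have ksa : cstar k = k by rewrite /k cstarZ conjcR /cform cstarM cstarK.
have k1 : rnorm k <= 1.
  rewrite /k rnormZr rnorm_cform_diag ger0_norm ?invr_ge0 ?sqr_ge0 //.
  by rewrite mulVf // expf_neq0.
have := rep_contractive_sa x ksa k1.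
rewrite /k repZ rnormZr ger0_norm ?invr_ge0 ?sqr_ge0 // ler_pdivrMl ?exprn_gt0 //.
move=> h.
rewrite -(ler_pXn2r (ltn0Sn 1)) ?nnegrE ?mulr_ge0 ?rnorm_ge0 //.
rewrite -rinner_diag -rinner_cform; apply: le_trans (rinner_le _ _) _.
by rewrite exprMn [rnorm x ^+ 2]expr2 mulrA ler_wpM2r ?rnorm_ge0.
Qed.

End Reps.

(** * Norms of matrices under representations *)

Section HilbertSum.
Variables (R : realType) (H : hilbertType R) (n : nat).
Implicit Types x y : 'I_n -> H.

Definition hsum_inner x y : R := \sum_(i < n) rinner (x i) (y i).

Lemma hsum_norm_ge0 x : 0 <= hsum_norm x.
Proof. exact: sqrtr_ge0. Qed.

Lemma hsum_inner_diag x : hsum_inner x x = hsum_norm x ^+ 2.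
Proof.
rewrite sqr_sqrtr; last by apply: sumr_ge0 => i _; exact: sqr_ge0.
by apply: eq_bigr => i _; rewrite rinner_diag.
Qed.

Lemma rnorm_le_hsum x i : rnorm (x i) <= hsum_norm x.
Proof.
rewrite -(ler_pXn2r (ltn0Sn 1)) ?nnegrE ?rnorm_ge0 ?hsum_norm_ge0 //.
rewrite -hsum_inner_diag /hsum_inner (bigD1 i) //= rinner_diag lerDl.
by apply: sumr_ge0 => j _; rewrite rinner_diag sqr_ge0.
Qed.

Lemma hsum_norm_le_sum x : hsum_norm x <= \sum_(i < n) rnorm (x i).
Proof.
have s0 : 0 <= \sum_(i < n) rnorm (x i) by apply: sumr_ge0 => i _; exact: rnorm_ge0.
rewrite -(ler_pXn2r (ltn0Sn 1)) ?nnegrE ?hsum_norm_ge0 //.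
rewrite -hsum_inner_diag /hsum_inner expr2 mulr_suml; apply: ler_sum => i _.
rewrite rinner_diag expr2 ler_wpM2l ?rnorm_ge0 // (bigD1 i) //= lerDl.
by apply: sumr_ge0 => j _; exact: rnorm_ge0.
Qed.

Lemma hsum_inner_le x y : hsum_inner x y <= hsum_norm x * hsum_norm y.
Proof.
apply: le_trans (_ : \sum_(i < n) rnorm (x i) * rnorm (y i) <= _).
  by apply: ler_sum => i _; exact: rinner_le.
set p := hsum_norm x; set q := hsum_norm y; set r := \sum_(i < n) _.
have p0 : 0 <= p := hsum_norm_ge0 x.
have q0 : 0 <= q := hsum_norm_ge0 y.
have [pe|pn] := eqVneq p 0.
  rewrite pe mul0r /r big1 // => i _.
  have : rnorm (x i) <= p := rnorm_le_hsum x i.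
  rewrite pe => xi.
  by have -> : rnorm (x i) = 0; [apply/eqP; rewrite eq_le xi rnorm_ge0|rewrite mul0r].
have [qe|qn] := eqVneq q 0.
  rewrite qe mulr0 /r big1 // => i _.
  have : rnorm (y i) <= q := rnorm_le_hsum y i.
  rewrite qe => xi.
  by have -> : rnorm (y i) = 0; [apply/eqP; rewrite eq_le xi rnorm_ge0|rewrite mulr0].
have pq : 0 < p * q by rewrite mulr_gt0 // lt_def ?pn ?qn.
have : 0 <= \sum_(i < n) (q * rnorm (x i) - p * rnorm (y i)) ^+ 2.
  by apply: sumr_ge0 => i _; exact: sqr_ge0.
have -> : \sum_(i < n) (q * rnorm (x i) - p * rnorm (y i)) ^+ 2 =
    q ^+ 2 * p ^+ 2 - 2 * p * q * r + p ^+ 2 * q ^+ 2.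
  rewrite -[X in _ * X - _]hsum_inner_diag -[X in _ + _ * X]hsum_inner_diag.
  rewrite /hsum_inner /r !mulr_sumr -sumrB -big_split /=; apply: eq_bigr => i _.
  by rewrite !rinner_diag; ring.
move=> h; have : 0 <= (p * q) * (p * q - r) by nra.
by rewrite pmulr_rge0 // subr_ge0.
Qed.

End HilbertSum.

Section MatrixNorm.
Variables (R : realType) (A : cstarAlgType R) (n : nat).
Implicit Types (s : starRep A) (T : 'M[A]_n).

Lemma ampliationE s T (x : 'I_n -> rep_space s) i :
  mxop_apply (ampliation s T) x i = \sum_(j < n) s (T i j) (x j).
Proof. by rewrite /mxop_apply; apply: eq_bigr => j _; rewrite mxE. Qed.

(** [T^* T] *)
Definition gram T : 'M[A]_n := \matrix_(i, j) \sum_(l < n) cform (T l i) (T l j).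

Lemma rep_sum s I (r : seq I) (F : I -> A) (x : rep_space s) :
  s (\sum_(i <- r) F i) x = \sum_(i <- r) s (F i) x.
Proof.
by elim: r => [|i r IHr]; rewrite ?big_nil ?rep0 // !big_cons repD IHr.
Qed.

Lemma rinner_suml (H : hilbertType R) I (r : seq I) (F : I -> H) y :
  rinner (\sum_(i <- r) F i) y = \sum_(i <- r) rinner (F i) y.
Proof.
elim: r => [|i r IHr]; last by rewrite !big_cons rinnerDl IHr.
by rewrite !big_nil /rinner linear0l.
Qed.

Lemma hsum_inner_gram s T x y :
  hsum_inner (mxop_apply (ampliation s (gram T)) x) y =
  hsum_inner (mxop_apply (ampliation s T) x) (mxop_apply (ampliation s T) y).
Proof.
have -> : hsum_inner (mxop_apply (ampliation s (gram T)) x) y =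
    \sum_(i < n) \sum_(j < n) \sum_(l < n)
       rinner (s (T l j) (x j)) (s (T l i) (y i)).
  apply: eq_bigr => i _; rewrite ampliationE rinner_suml; apply: eq_bigr => j _.
  rewrite mxE rep_sum rinner_suml; apply: eq_bigr => l _.
  by rewrite rinner_cform.
under eq_bigr do rewrite exchange_big.
rewrite exchange_big; apply: eq_bigr => l _ /=.
rewrite !ampliationE rinnerC rinner_suml; apply: eq_bigr => i _.
by rewrite rinnerC rinner_suml.
Qed.

Definition mx_bounded s T (M : R) := forall x : 'I_n -> rep_space s,
  hsum_norm (mxop_apply (ampliation s T) x) <= M * hsum_norm x.

Lemma gram_bounded s T M : 0 <= M -> mx_bounded s T M ->
  mx_bounded s (gram T) (M ^+ 2).
Proof.
move=> M0 TM x; set v := mxop_apply _ _.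
have [->|v0] := eqVneq (hsum_norm v) 0; first by rewrite mulr_ge0 ?sqr_ge0 ?hsum_norm_ge0.
have v_gt0 : 0 < hsum_norm v by rewrite lt_def v0 hsum_norm_ge0.
rewrite -(ler_pM2r v_gt0) -expr2 -hsum_inner_diag {1}/v hsum_inner_gram.
apply: le_trans (hsum_inner_le _ _) _.
have -> : M ^+ 2 * hsum_norm x * hsum_norm v = (M * hsum_norm x) * (M * hsum_norm v) by ring.
by apply: ler_pM; rewrite ?hsum_norm_ge0.
Qed.

Lemma entry_bounded s T M i j : mx_bounded s T M ->
  forall y, rnorm (s (T i j) y) <= M * rnorm y.
Proof.
move=> TM y; pose x k : rep_space s := if k == j then y else 0.
have <- : hsum_norm x = rnorm y.
  rewrite /hsum_norm (bigD1 j) //= big1 ?addr0 /x ?eqxx ?sqrtr_sqr ?ger0_norm ?rnorm_ge0 //.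
  by move=> k /negbTE ->; rewrite rnorm0 expr0n.
apply: le_trans (TM x); apply: le_trans (rnorm_le_hsum _ i).
rewrite ampliationE (bigD1 j) //= big1 ?addr0 /x ?eqxx // => k /negbTE ->.
by rewrite linear0.
Qed.

(** Were [t > M], Bernoulli's inequality would make [(t / M)^(2^k)] unbounded. *)
Lemma le_of_pow2_le (t C M : R) : 0 <= t -> 0 <= M ->
  (forall k, t ^+ (2 ^ k) <= C * M ^+ (2 ^ k)) -> t <= M.
Proof.
move=> t0 M0 tM; rewrite leNgt; apply/negP => Mt.
have t_gt0 : 0 < t by apply: le_lt_trans Mt.
have [Me|Mn] := eqVneq M 0.
  by have := tM 0; rewrite Me mulr0 expr1 leNgt t_gt0.
have M_gt0 : 0 < M by rewrite lt_def Mn.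
pose q := t / M.
have q1 : 1 < q by rewrite /q ltr_pdivlMr // mul1r.
have bern k : 1 + k%:R * (q - 1) <= q ^+ k.
  elim: k => [|k IHk]; first by rewrite mul0r addr0 expr0.
  rewrite exprS -natr1.
  have k0 : 0 <= k%:R :> R by rewrite ler0n.
  have : q * (1 + k%:R * (q - 1)) <= q * q ^+ k by rewrite ler_wpM2l //; lra.
  have : 0 <= k%:R * (q - 1) ^+ 2 by rewrite mulr_ge0 // sqr_ge0.
  lra.
pose k := (Num.trunc (C / (q - 1))).+1.
have hk : C / (q - 1) < k%:R by exact: truncnS_gt.
have kk : k%:R <= (2 ^ k)%:R :> R by rewrite ler_nat ltnW // ltn_expl.
have : q ^+ (2 ^ k) <= C.
  by rewrite /q expr_div_n ler_pdivrMr ?exprn_gt0 // tM.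
have := bern (2 ^ k)%N.
move: hk; rewrite ltr_pdivrMr ?subr_gt0 // => hk.
have : k%:R * (q - 1) <= (2 ^ k)%:R * (q - 1) by rewrite ler_wpM2r // subr_ge0 ltW.
lra.
Qed.

(** The C*-identity, squared repeatedly, turns the crude entrywise bound for
    [p T_k] into the sharp bound for [p T]. *)
Lemma separating_mx_norm (F : rep_set A) p T (M : R) : separating F -> 0 <= M ->
  (forall s, F s -> mx_bounded s T M) ->
  forall x : 'I_n -> rep_space p, hsum_norm x <= 1 ->
    hsum_norm (mxop_apply (ampliation p T) x) <= M.
Proof.
move=> Fsep M0 TM x x1.
pose S k := iter k gram T.
have SM k : forall s, F s -> mx_bounded s (S k) (M ^+ (2 ^ k)).
  elim: k => [|k IHk] s Fs /=; first by rewrite expr1; exact: TM.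
  rewrite expnSr exprM; apply: gram_bounded; first exact: exprn_ge0.
  exact: IHk.
have entry k i j : rnorm (S k i j) <= M ^+ (2 ^ k).
  apply: (separating_norm Fsep); first exact: exprn_ge0.
  by move=> s Fs; apply: entry_bounded; exact: SM.
apply: (@le_of_pow2_le _ (n%:R * n%:R)) => // [|k]; first exact: hsum_norm_ge0.
have le1 : hsum_norm (mxop_apply (ampliation p T) x) ^+ (2 ^ k) <=
    hsum_norm (mxop_apply (ampliation p (S k)) x).
  elim: k => [|k IHk]; first by rewrite expr1.
  rewrite expnSr exprM.
  apply: le_trans (_ : hsum_norm (mxop_apply (ampliation p (S k)) x) ^+ 2 <= _).
    by rewrite ler_pXn2r // nnegrE ?exprn_ge0 ?hsum_norm_ge0.
  rewrite -hsum_inner_diag -hsum_inner_gram.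
  apply: le_trans (hsum_inner_le _ _) _.
  by rewrite -[leRHS]mulr1 ler_wpM2l ?hsum_norm_ge0.
apply: le_trans le1 _; apply: le_trans (hsum_norm_le_sum _) _.
rewrite -mulrA mulr_natl -[X in _ *+ X](card_ord n) -sumr_const.
apply: ler_sum => i _; rewrite ampliationE mulr_natl -[X in _ *+ X](card_ord n) -sumr_const.
have rsum (I : Type) (r : seq I) (G : I -> rep_space p) :
    rnorm (\sum_(j <- r) G j) <= \sum_(j <- r) rnorm (G j).
  elim: r => [|j r IHr]; first by rewrite !big_nil rnorm0.
  by rewrite !big_cons; apply: le_trans (ler_rnormD _ _) _; rewrite lerD2l.
apply: le_trans (rsum _ _ _) _; apply: ler_sum => j _.
apply: le_trans (rep_contractive _ _) _; rewrite -[leRHS]mulr1.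
apply: ler_pM; rewrite ?rnorm_ge0 ?entry //.
exact: le_trans (rnorm_le_hsum _ _) x1.
Qed.

End MatrixNorm.

(** * Subspaces of finite-dimensional spaces *)

Section FiniteDimension.
Variable K : fieldType.

Definition linear_closed_set (V : lmodType K) (N : V -> Prop) :=
  N 0 /\ forall (c : K) x y, N x -> N y -> N (c *: x + y).

(** A matrix of maximal rank among those with row space inside [P]: a vector of
    [P] outside the row space would increase the rank. *)
Lemma subspace_rowspace m (P : 'rV[K]_m -> Prop) : linear_closed_set P ->
  exists B : 'M[K]_m, forall u, P u <-> (u <= B)%MS.
Proof.
move=> [P0 PD].
pose Q r := `[< exists B : 'M[K]_m, (forall u, (u <= B)%MS -> P u) /\ \rank B = r >].
have exQ : exists r, Q r.
  exists 0%N; apply/asboolP; exists 0; split; last exact: mxrank0.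
  by move=> u; rewrite submx0 => /eqP ->.
have Qle r : Q r -> (r <= m)%N.
  by move=> /asboolP[B [_ <-]]; exact: rank_leq_row.
have [r /asboolP[B [BP Br]] rmax] := ex_maxnP exQ Qle.
exists B => u; split; last exact: BP.
move=> Pu; apply: contraT => uB.
have /rmax : Q (\rank (B + u)%MS).
  apply/asboolP; exists (B + u)%MS; split=> // v /sub_addsmxP[[D E] ->].
  rewrite addrC [E]mx11_scalar mul_scalar_mx; apply: PD => //=.
  exact/BP/submxMl.
rewrite -Br leqNgt => /negP; case; apply: rank_ltmx.
rewrite /ltmx addsmxSl /=; apply: contra uB => h.
exact: submx_trans (addsmxSr _ _) h.
Qed.

Variable V : lmodType K.

(** The alternative in the conclusion says that a proper subspace needs fewer
    generators; inductions on the dimension rest on it. *)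
Lemma subspace_span d (v : 'I_d -> V) (N : V -> Prop) :
  (forall x, exists c : 'I_d -> K, x = \sum_(i < d) c i *: v i) ->
  linear_closed_set N ->
  exists (e : nat) (w : 'I_e -> V),
    [/\ forall i, N (w i),
        forall x, N x -> exists c : 'I_e -> K, x = \sum_(i < e) c i *: w i
      & (forall x, N x) \/ (e < d)%N].
Proof.
move=> vspan [N0 ND].
pose phi (u : 'rV[K]_d) := \sum_(i < d) u 0 i *: v i.
have phiP (c : K) u u' : phi (c *: u + u') = c *: phi u + phi u'.
  rewrite /phi scaler_sumr -big_split; apply: eq_bigr => i _.
  by rewrite !mxE scalerDl scalerA.
have phi0 : phi 0 = 0 by rewrite /phi big1 // => i _; rewrite mxE scale0r.
have phisurj x : exists u, x = phi u.
  have [c ->] := vspan x; exists (\row_i c i).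
  by apply: eq_bigr => i _; rewrite mxE.
have [|B BP] := @subspace_rowspace _ (fun u => N (phi u)).
  by split=> [|c x y Nx Ny]; [rewrite phi0|rewrite phiP; exact: ND].
exists (\rank B), (fun i => phi (row i (row_base B))); split.
- by move=> i; apply/BP; rewrite (submx_trans (row_sub _ _)) // eq_row_base.
- move=> x; have [u ->] := phisurj x; move=> /BP.
  rewrite -(eq_row_base B) => /submxP[D ->].
  exists (fun i => D 0 i).
  rewrite mulmx_sum_row.
  elim: (index_enum _) => [|i r IHr]; first by rewrite !big_nil.
  by rewrite !big_cons phiP IHr.
- have [Bd|] := ltnP (\rank B) d; first by right.
  move=> Bd; left=> x; have [u ->] := phisurj x; apply/BP/submx_full.
  by rewrite /row_full eqn_leq rank_leq_col.
Qed.

Lemma finite_dim_fin (I : finType) (v : I -> V) :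
  (forall x, exists c : I -> K, x = \sum_i c i *: v i) -> finite_dim V.
Proof.
move=> vspan; exists #|I|, (v \o enum_val) => x.
have [c ->] := vspan x; exists (c \o enum_val).
by rewrite (reindex (@enum_val I I)) //=; exact/onW_bij/enum_val_bij.
Qed.

End FiniteDimension.

Lemma finite_dim_ffun (K : fieldType) (V : lmodType K) m :
  finite_dim V -> finite_dim {ffun 'I_m -> V}.
Proof.
move=> [d [v vspan]].
apply: (@finite_dim_fin _ _ ('I_m * 'I_d)%type
  (fun p => [ffun k => if k == p.1 then v p.2 else 0])) => f.
have [c cE] := choice (fun k => vspan (f k)).
exists (fun p => c p.1 p.2); apply/ffunP => k; rewrite sum_ffunE cE.
rewrite -(pair_big xpredT xpredT (fun i j => (c i j *: [ffun l => if l == i then v j else 0] : {ffun _ -> _}) k)) /=.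
rewrite (bigD1 k) //= [X in _ + X]big1 ?addr0.
  by apply: eq_bigr => j _; rewrite !ffunE eqxx.
by move=> i /negbTE ik; rewrite big1 // => j _; rewrite !ffunE eq_sym ik scaler0.
Qed.

(** * Restriction of a representation to an invariant subspace *)

Section Subspace.
Variables (R : realType) (H : hilbertType R) (M : set H).
Variable (hM : closed_subspace M).

(** Indexed by the proof of closedness, so that the structures below can be
    inferred from the type alone. *)
Definition subspace_pred of closed_subspace M : {pred H} := fun x => `[< M x >].

Lemma subspace_pred_submod : GRing.submod_closed (subspace_pred hM).
Proof.
have [M0 MD _] := hM; split; first exact/asboolP.
by move=> c x y /asboolP Mx /asboolP My; apply/asboolP; exact: MD.
Qed.

HB.instance Definition _ :=
  GRing.isSubmodClosed.Build R[i] H (subspace_pred hM)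
    (GRing.submod_closed_semi subspace_pred_submod).

Record subhilbert := SubHilbert { subhilbert_val :> H;
  _ : subhilbert_val \in subspace_pred hM }.

HB.instance Definition _ := [isSub for subhilbert_val].
HB.instance Definition _ := [Choice of subhilbert by <:].
HB.instance Definition _ := [SubChoice_isSubLmodule of subhilbert by <:].

Lemma subhilbert_mem (x : subhilbert) : M (val x).
Proof. by have /asboolP := valP x. Qed.

Definition subhilbert_norm (x : subhilbert) : R[i] := `|val x|.

Lemma subhilbert_normD x y :
  subhilbert_norm (x + y) <= subhilbert_norm x + subhilbert_norm y.
Proof. exact: ler_normD. Qed.
Lemma subhilbert_normZ (c : R[i]) x : subhilbert_norm (c *: x) = `|c| * subhilbert_norm x.
Proof. exact: normrZ. Qed.
Lemma subhilbert_norm0_eq0 x : subhilbert_norm x = 0 -> x = 0.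
Proof. by move=> /normr0_eq0 x0; apply/val_inj. Qed.

HB.instance Definition _ := Lmodule_isNormed.Build R[i] subhilbert
  subhilbert_normD subhilbert_normZ subhilbert_norm0_eq0.

Lemma subhilbert_complete (F : set_system subhilbert) :
  ProperFilter F -> cauchy F -> cvg F.
Proof.
move=> FF /cauchyP Fc.
pose G : set_system H := fmap val F.
have Gc : cauchy G.
  apply: cauchy_exP => e e0; have [x Fx] := Fc e e0.
  exists (val x); rewrite -ball_normE; move: Fx; rewrite -ball_normE; exact.
have : cvg G by exact: cauchy_cvg Gc.
move=> /cvg_ex[l Gl].
have Ml : M l.
  have [_ _ Mcl] := hM; apply: (@closed_cvg _ _ F _ val M Mcl _ l Gl).
  by apply: nearW => x; exact: subhilbert_mem.
have l_in : l \in subspace_pred hM by apply/asboolP.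
apply/cvg_ex; exists (SubHilbert l_in); apply/cvgrPdist_lt => e e0.
by have /cvgrPdist_lt/(_ e e0) := Gl.
Qed.

HB.instance Definition _ := Uniform_isComplete.Build subhilbert subhilbert_complete.

Definition subhilbert_inner (x y : subhilbert) : R[i] := inner (val x) (val y).

Lemma subhilbert_inner_bilinear : bilinear_for
  (GRing.Scale.Law.clone _ _ *%R _) (GRing.Scale.Law.clone _ _ (Num.conj \; *%R) _)
  subhilbert_inner.
Proof.
split=> [y|x] c u v; first by rewrite /subhilbert_inner linearPl.
by rewrite /subhilbert_inner linearPr.
Qed.

HB.instance Definition _ := bilinear_isBilinear.Build R[i] subhilbert subhilbert R[i] _ _
  subhilbert_inner subhilbert_inner_bilinear.

Lemma subhilbert_inner_herm (x y : subhilbert) :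
  subhilbert_inner x y = (-1) ^+ false * (subhilbert_inner y x)^*.
Proof. exact: hermC. Qed.

HB.instance Definition _ := isHermitianSesquilinear.Build R[i] subhilbert false Num.conj
  subhilbert_inner subhilbert_inner_herm.

Lemma subhilbert_inner_gt0 (x : subhilbert) : x != 0 -> 0 < subhilbert_inner x x.
Proof. by move=> x0; apply: neq0_dnorm_gt0; rewrite -(inj_eq val_inj) in x0. Qed.

HB.instance Definition _ := isDotProduct.Build R[i] subhilbert
  subhilbert_inner subhilbert_inner_gt0.

Lemma subhilbert_inner_norm (x : subhilbert) : subhilbert_inner x x = `|x| ^+ 2.
Proof. exact: inner_norm. Qed.

HB.instance Definition _ := CompleteNormedModule_isHilbert.Build R subhilbert
  subhilbert_inner_norm.

End Subspace.

Lemma isometry_continuous (K : numFieldType) (V W : normedModType K) (j : V -> W)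
    (f : V -> V) (g : W -> W) : (forall x y, `|j x - j y| = `|x - y|) ->
  continuous g -> (forall x, j (f x) = g (j x)) -> continuous f.
Proof.
move=> jiso gcont jf x.
have jc : j y @[y --> x] --> j x.
  apply/cvgrPdist_lt => e e0; near=> y; rewrite jiso; near: y.
  by apply: cvgr_dist_lt => //; exact: cvg_id.
apply/cvgrPdist_lt => e e0; near=> y; rewrite -jiso !jf; near: y.
have /cvgrPdist_lt/(_ e e0) h := gcont (j x).
exact: jc _ h.
Unshelve. all: by end_near. Qed.

Section Subrep.
Variables (R : realType) (A : cstarAlgType R) (s : starRep A).
Variables (M : set (rep_space s)) (hM : closed_subspace M).
Hypothesis (Minv : forall a x, M x -> M (s a x)).

Lemma subrep_mem a (x : subhilbert hM) : s a (val x) \in subspace_pred hM.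
Proof. by apply/asboolP; apply: Minv; exact: subhilbert_mem. Qed.

Definition subrep_fun a (x : subhilbert hM) : subhilbert hM := SubHilbert (subrep_mem a x).

Lemma subrep_fun_linear a : linear (subrep_fun a).
Proof. by move=> c x y; apply: val_inj; rewrite /= linearP. Qed.

HB.instance Definition _ a := GRing.isLinear.Build R[i] (subhilbert hM) (subhilbert hM) _
  (subrep_fun a) (subrep_fun_linear a).

Lemma subrep_fun_continuous a : continuous (subrep_fun a).
Proof.
apply: (@isometry_continuous _ (subhilbert hM) (rep_space s) val _ (s a)) => //.
exact: op_continuous.
Qed.

Definition subrep_op a := @BoundedOp R _ (subrep_fun a) (@subrep_fun_continuous a).

Lemma subrep_linear (z : R[i]) (a b : A) (x : subhilbert hM) :
  subrep_op (z *: a + b) x = z *: subrep_op a x + subrep_op b x.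
Proof. by apply: val_inj; rewrite /= rep_linear. Qed.
Lemma subrep_mul (a b : A) (x : subhilbert hM) :
  subrep_op (cmul a b) x = subrep_op a (subrep_op b x).
Proof. by apply: val_inj; rewrite /= rep_mul. Qed.
Lemma subrep_star (a : A) (x y : subhilbert hM) :
  inner (subrep_op a x) y = inner x (subrep_op (cstar a) y).
Proof. exact: rep_star. Qed.

Definition subrep : starRep A := StarRep subrep_linear subrep_mul subrep_star.

End Subrep.

(** * Orthogonality *)

Section Orthogonality.
Variables (R : realType) (H : hilbertType R).
Implicit Types (x y : H) (S : set H).

Lemma inner_eq0_diag x : inner x x = 0 -> x = 0.
Proof.
move=> xx; apply: rnorm0_eq0; apply/eqP; rewrite -sqrf_eq0 -rinner_diag.
by rewrite /rinner xx.
Qed.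

Lemma inner_le x y : complex.Re `|inner x y| <= rnorm x * rnorm y.
Proof.
set z := inner x y; set r := complex.Re `|z|.
have r0 : 0 <= r by rewrite -lecR /r RRe_real ?normr_ge0 // realE normr_ge0.
have [->|rn] := eqVneq r 0; first by rewrite mulr_ge0 ?rnorm_ge0.
have r_gt0 : 0 < r by rewrite lt_def rn.
rewrite -(ler_pM2r r_gt0).
have -> : r * r = rinner x (z *: y).
  rewrite /rinner linearZr_LR /= -/z.
  have -> : z^* * z = (r * r)%:C%C; last by [].
  by rewrite mulrC -sqr_normc -expr2 rmorphXn; congr (_ ^+ 2).
by apply: le_trans (rinner_le _ _) _; rewrite rnormZ -/r mulrCA mulrC.
Qed.

Definition orthogonal_set S : set H := [set y | forall m, S m -> inner y m = 0].

Lemma orthogonal_set_closed S : closed_subspace (orthogonal_set S).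
Proof.
split.
- by move=> m _; rewrite linear0l.
- by move=> z x y Sx Sy m Sm; rewrite linearPl /= Sx // Sy // mulr0 addr0.
move=> p pcl m Sm; apply: contrapT => pm.
set c := complex.Re `|inner p m|.
have c0 : 0 < c.
  rewrite -ltcR /c RRe_real ?normr_gt0; last by rewrite realE normr_ge0.
  exact/eqP.
pose e := c / (rnorm m + 1).
have m1 : 0 < rnorm m + 1 by rewrite ltr_wpDl // rnorm_ge0.
have e0 : 0 < e by rewrite divr_gt0.
have [q [Sq pq]] : (orthogonal_set S `&` ball p e%:C%C) !=set0.
  by apply: pcl; apply: nbhsx_ballx; rewrite ltcR.
move: pq; rewrite -ball_normE /= -rnormE ltcR => pq.
have h := inner_le (p - q) m.
rewrite linearBl /= (Sq m Sm) subr0 in h.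
have {}h : c <= rnorm (p - q) * rnorm m := h.
have : rnorm (p - q) * rnorm m <= e * rnorm m by rewrite ler_wpM2r ?rnorm_ge0 // ltW.
have : e * (rnorm m + 1) = c by rewrite /e divfK // gt_eqF.
move: e0 h; clear; move: (rnorm (p - q)) (rnorm m) => u v.
clearbody e c; lra.
Qed.

(** Gram-Schmidt without normalization: the residual of [y] is corrected along
    the residual [q] of the new vector.  If [q = 0], the coefficient [t] is a
    division by zero, hence zero, as it should be. *)
Lemma orthogonal_projection (u : nat -> H) m y :
  exists c : nat -> R[i], forall j, (j < m)%N ->
    inner (y - \sum_(i < m) c i *: u i) (u j) = 0.
Proof.
elim: m y => [|m IHm] y; first by exists (fun=> 0).
have [c cy] := IHm y; have [b bu] := IHm (u m).
set y' := y - _ in cy; set q := u m - _ in bu.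
pose t := inner y' q / inner q q.
have yq : inner (y' - t *: q) q = 0.
  rewrite linearBl /= linearZl_LR /= /t.
  have [qq|qq] := eqVneq (inner q q) 0; last by rewrite divfK // subrr.
  by rewrite qq mulr0 subr0 (inner_eq0_diag qq) linear0r.
have yu j : (j < m)%N -> inner (y' - t *: q) (u j) = 0.
  by move=> jm; rewrite linearBl /= linearZl_LR /= cy // bu // mulr0 subrr.
exists (fun i => if i == m then t else c i - t * b i) => j.
rewrite big_ord_recr /= eqxx.
have -> : \sum_(i < m) (if (i : nat) == m then t else c i - t * b i) *: u i =
    \sum_(i < m) c i *: u i - t *: \sum_(i < m) b i *: u i.
  rewrite scaler_sumr -sumrB; apply: eq_bigr => i _.
  by rewrite ltn_eqF // scalerBl scalerA.
have -> : y - (\sum_(i < m) c i *: u i - t *: \sum_(i < m) b i *: u i + t *: u m) =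
    y' - t *: q.
  by rewrite /y' /q; lmod R[i] H.
rewrite ltnS leq_eqVlt => /predU1P[->|]; last exact: yu.
have -> : u m = q + \sum_(i < m) b i *: u i by rewrite /q subrK.
rewrite linearDr /= yq add0r linear_sumr /= big1 // => i _.
by rewrite linearZr_LR /= yu // mulr0.
Qed.

End Orthogonality.

(** * Finite-dimensional irreducible representations *)

Section IrreducibleSubrep.
Variables (R : realType) (A : cstarAlgType R).
Implicit Types (s t p : starRep A) (a b : A).

Definition spanned s (d : nat) := exists v : 'I_d -> rep_space s,
  forall x, exists c : 'I_d -> R[i], x = \sum_(i < d) c i *: v i.

Lemma subrep_spanned t d (M : set (rep_space t)) (hM : closed_subspace M)
    (Minv : forall a x, M x -> M (t a x)) :
  spanned t d -> M <> setT ->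
  exists2 e, (e < d)%N & spanned (subrep hM Minv) e.
Proof.
move=> [v vspan] MT.
have [|e [w [wM Mw ed]]] := @subspace_span _ _ d v M vspan.
  by have [M0 MD _] := hM; split.
exists e.
  case: ed => // Mall; case: MT; apply/seteqP; split=> // x _; exact: Mall.
have wmem i : w i \in subspace_pred hM by apply/asboolP.
exists (fun i => SubHilbert (wmem i)) => x.
have [c xc] := Mw (val x) (subhilbert_mem x).
exists c; apply: val_inj; rewrite /= xc.
have vsum (r : seq 'I_e) : \sum_(i <- r) c i *: w i =
    val (\sum_(i <- r) c i *: SubHilbert (wmem i)).
  by elim: r => [|i r IHr]; rewrite ?big_nil // !big_cons IHr.
exact: vsum.
Qed.

(** Suppose [t] has a nontrivial invariant subspace.  If the self-adjoint [a] is
    killed on it, then [t a] maps everything into the orthogonal complement;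
    were [a] killed there too, [t (a^2)] would vanish, and with it [t a].  So [a]
    survives on one of the two, which are smaller. *)
Lemma finite_dim_irreps_detect d t a x : spanned t d -> cstar a = a ->
  t a x <> 0 ->
  exists s, [/\ irreducible_rep s, finite_dim_rep s & exists y, s a y <> 0].
Proof.
elim/ltn_ind: d t x => d IHd t x td asa tax.
have [tirr|/not_andP[|]] := pselect (irreducible_rep t).
- by exists t; split=> //; [have [v vspan] := td; exists d, v|exists x].
- by move=> []; exists a, x.
move=> /existsNP[M] /not_implyP[hM] /not_implyP[Minv] /not_orP[M0 MT].
have descend N (hN : closed_subspace N) (Ninv : forall b y, N y -> N (t b y)) y :
    N <> setT -> N y -> t a y <> 0 ->
    exists s, [/\ irreducible_rep s, finite_dim_rep s & exists y, s a y <> 0].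
  move=> NT Ny tay; have [e ed se] := subrep_spanned hN Ninv td NT.
  have y_in : y \in subspace_pred hN by apply/asboolP.
  apply: (IHd e ed (subrep hN Ninv) (SubHilbert y_in) se asa).
  by move=> /(congr1 val).
have [[y [My tay]]|Mkill] := pselect (exists y, M y /\ t a y <> 0).
  exact: (descend M hM Minv y).
have [[y [My tay]]|Okill] := pselect (exists y, orthogonal_set M y /\ t a y <> 0).
  apply: (descend (orthogonal_set M) (orthogonal_set_closed M) _ y) => //.
    by move=> b z Oz m Mm; rewrite rep_star Oz //; exact: Minv.
  move=> OT; apply: M0; apply/seteqP; split=> [m Mm|m ->]; last by case: hM.
  apply: inner_eq0_diag; have : orthogonal_set M m by rewrite OT.
  exact.
exfalso; apply: tax; apply: inner_eq0_diag.
rewrite rep_star asa (_ : t a (t a x) = 0) ?linear0r //.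
apply: contrapT => taax; apply: Okill; exists (t a x); split=> // m Mm.
rewrite rep_star asa (_ : t a m = 0) ?linear0r //.
by apply: contrapT => tam; apply: Mkill; exists m.
Qed.

(** [A] modulo the common kernel is finite-dimensional, spanned by the classes of
    some [al i]; so the orbit of a vector [x0] under [p] is spanned by the
    [p (al i) x0].  By irreducibility only zero is orthogonal to the orbit, and a
    finite span whose orthogonal complement vanishes is the whole space, by
    projection. *)
Lemma weakly_equiv_finite_dim s p : finite_dim_rep s -> irreducible_rep p ->
  weakly_equiv s p -> finite_dim_rep p.
Proof.
move=> sfd [[a0 [x0 pa0]] pirr] sp.
have [d [v vspan]] := sfd.
(* [a] modulo the kernel of [s] is recorded by its values on a spanning family. *)
pose N (f : {ffun 'I_d -> rep_space s}) := exists a, forall j, f j = s a (v j).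
have Nlin : linear_closed_set N.
  split; first by exists 0 => j; rewrite ffunE rep0.
  move=> c f g [a fa] [b gb]; exists (c *: a + b) => j.
  by rewrite !ffunE fa gb rep_linear.
have [D [V Vspan]] := finite_dim_ffun d sfd.
have [e [w [wN Nw _]]] := subspace_span Vspan Nlin.
have [al alE] := choice wN.
have pspan a : exists c : 'I_e -> R[i], forall y,
    p a y = \sum_(i < e) c i *: p (al i) y.
  have [|c cE] := Nw [ffun j => s a (v j)]; first by exists a => j; rewrite ffunE.
  exists c => y.
  pose b := a - \sum_(i < e) c i *: al i.
  have repsum t z : t b z = t a z - \sum_(i < e) c i *: t (al i) z.
    by rewrite repB rep_sum; congr (_ - _); apply: eq_bigr => i _; rewrite repZ.
  have bs : rep_ker s b.
    move=> z; have [k ->] := vspan z; rewrite linear_sum big1 // => j _.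
    rewrite linearZ /= repsum; have /ffunP/(_ j) := cE.
    rewrite ffunE sum_ffunE => ->; rewrite -sumrB big1 ?scaler0 // => i _.
    by rewrite ffunE alE subrr.
  have := bs; rewrite sp => /(_ y); rewrite repsum => /eqP.
  by rewrite subr_eq0 => /eqP.
pose S := [set y | exists a, y = p a x0].
have Sinv b y : orthogonal_set S y -> orthogonal_set S (p b y).
  by move=> Oy m [a ->]; rewrite rep_star -rep_mul; apply: Oy; exists (cmul (cstar b) a).
have O0 y : orthogonal_set S y -> y = 0.
  have [->//|OT] := pirr _ (orthogonal_set_closed S) Sinv.
  case: pa0; apply: inner_eq0_diag.
  have : orthogonal_set S (p a0 x0) by rewrite OT.
  by apply; exists a0.
pose u (i : nat) := if insub i is Some k then p (al k) x0 else 0.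
have uE (i : 'I_e) : u i = p (al i) x0 by rewrite /u valK.
exists e, (fun i => p (al i) x0) => y.
have [c cy] := orthogonal_projection u e y.
exists (fun i => c i); apply/eqP; rewrite -subr_eq0; apply/eqP.
under eq_bigr do rewrite -uE.
apply: O0 => m [a ->]; have [k ->] := pspan a.
rewrite linear_sumr big1 // => i _; rewrite linearZr_LR /= -uE cy ?mulr0 //.
Qed.

End IrreducibleSubrep.

(** * Residually finite-dimensional algebras *)

Section Main.
Variables (R : realType) (A : cstarAlgType R).

Lemma mx_bounded_norm (s : starRep A) n (T : 'M[A]_n) (M : R) :
  (mxop_norm (ampliation s T) <= M%:E)%E -> mx_bounded s T M.
Proof.
move=> TM x.
have scal (r : R) (z : 'I_n -> rep_space s) : 0 <= r ->
    hsum_norm (fun i => r%:C%C *: z i) = r * hsum_norm z.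
  move=> r0; apply/eqP; rewrite -(eqrXn2 (n := 2)) ?mulr_ge0 ?hsum_norm_ge0 //.
  rewrite exprMn -!hsum_inner_diag /hsum_inner mulr_sumr; apply/eqP.
  by apply: eq_bigr => i _; rewrite rinnerZl rinnerZr mulrA expr2.
have scalT (r : R) : mxop_apply (ampliation s T) (fun i => r%:C%C *: x i) =
    (fun i => r%:C%C *: mxop_apply (ampliation s T) x i).
  apply/funext => i; rewrite /mxop_apply scaler_sumr.
  by apply: eq_bigr => j _; rewrite linearZ.
have [x0|xn] := eqVneq (hsum_norm x) 0.
  have -> : x = (fun i => 0%:C%C *: x i).
    apply/funext => i; rewrite scale0r; apply: rnorm0_eq0; apply/eqP.
    by rewrite eq_le rnorm_ge0 -x0 rnorm_le_hsum.
  by rewrite scalT !scal // !mul0r mulr0.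
have x_gt0 : 0 < hsum_norm x by rewrite lt_def xn hsum_norm_ge0.
pose r := (hsum_norm x)^-1.
have r0 : 0 <= r by rewrite invr_ge0 ltW.
have : ((hsum_norm (mxop_apply (ampliation s T) (fun i => r%:C%C *: x i)))%:E <= M%:E)%E.
  apply: le_trans TM; apply: ereal_sup_ubound.
  exists (fun i => r%:C%C *: x i) => //=.
  by rewrite scal // /r mulVf.
by rewrite lee_fin scalT scal // /r ler_pdivrMl // mulrC.
Qed.

Lemma mxop_norm_ge0 (H : hilbertType R) n (S : 'M[boundedOp H]_n) :
  (0 <= mxop_norm S)%E.
Proof.
apply: le_trans (_ : (hsum_norm (mxop_apply S (fun=> 0)))%:E <= _)%E.
  by rewrite lee_fin hsum_norm_ge0.
apply: ereal_sup_ubound; exists (fun=> 0) => //=.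
rewrite (le_trans (hsum_norm_le_sum _)) // big1 // => i _.
exact: rnorm0.
Qed.

Definition finite_dim_irrep (s : starRep A) := irreducible_rep s /\ finite_dim_rep s.

(** The element [a^* a] is self-adjoint and killed by the same representations as
    [a]. *)
Lemma finite_dim_irreps_separating : residually_finite_dim A ->
  separating finite_dim_irrep.
Proof.
move=> [F0 [F0fd F0sep]] a aF; apply: F0sep => s Fs x; rewrite rep0.
apply: contrapT => sax.
have [d sd] := F0fd s Fs.
have bsa : cstar (cform a a) = cform a a by rewrite /cform cstarM cstarK.
have sbx : s (cform a a) x <> 0.
  move=> sb0; apply: sax; apply: rnorm0_eq0; apply/eqP.
  by rewrite -sqrf_eq0 -rinner_diag -rinner_cform sb0 /rinner linear0l.
have [t [tirr tfd [y []]]] := finite_dim_irreps_detect sd bsa sbx.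
by rewrite /cform rep_mul aF // linear0.
Qed.

End Main.

Theorem theorem3p6 (R : realType) (A : cstarAlgType R) (pi : starRep A)
    (hA : residually_finite_dim A)
    (hpi : irreducible_rep pi)
    (hT : exists (n : nat) (T : 'M[A]_n),
       (0 < n)%N /\
       (sup_class_norm (not_weak_classes pi) T
          < mxop_norm (ampliation pi T))%E) :
  finite_dim_rep pi.
Proof.
have [n [T [_ lt]]] := hT; apply: contrapT => pi_inf.
have Fsep := finite_dim_irreps_separating hA.
set c := sup_class_norm _ _ in lt.
have leF s : finite_dim_irrep s -> (mxop_norm (ampliation s T) <= c)%E.
  move=> [sirr sfd]; apply: ereal_sup_ubound; exists s => //; split; first by exists s.
  by exists s => // sp; apply: pi_inf; exact: weakly_equiv_finite_dim sp.
have [s0 Fs0] : exists s : starRep A, finite_dim_irrep s.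
  apply: contrapT => noF; have [[a [x pax]] _] := hpi; apply: pax.
  by rewrite (Fsep a) ?rep0 // => s Fs; case: noF; exists s.
have c0 : (0 <= c)%E := le_trans (mxop_norm_ge0 _) (leF s0 Fs0).
have cfin : c \is a fin_num.
  by rewrite ge0_fin_numE //; apply: lt_le_trans lt _; rewrite leey.
have cE : c = (fine c)%:E by rewrite fineK.
have M0 : 0 <= fine c by rewrite fine_ge0.
have bnd s : finite_dim_irrep s -> mx_bounded s T (fine c).
  by move=> Fs; apply: mx_bounded_norm; rewrite -cE; exact: leF.
move: lt; rewrite ltNge => /negP; apply; rewrite cE.
apply: ge_ereal_sup => _ [x x1 <-]; rewrite lee_fin.
exact: (separating_mx_norm Fsep M0 bnd).
Qed.
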